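(* Let $G$ be a finite group and let $V$ be a finite-dimensional representation of $G$ over a field $\Bbbk$. If there exists a geometric separating algebra $A\subseteq \Bbbk[V]^G$ which is a polynomial ring, then the action of $G$ on $V$ is generated by reflections.
   Context: $\Bbbk[V]$ denotes the symmetric algebra on the dual space $V^*$ (a polynomial ring with its standard grading), with $G$ acting by $(\sigma\cdot f)(u)=f(\sigma^{-1}u)$; $\Bbbk[V]^G$ is the ring of invariants. Let $\overline{\Bbbk}$ be an algebraic closure of $\Bbbk$ and $\overline V=V\otimes_\Bbbk\overline{\Bbbk}$, with the extended $G$-action; elements of $\Bbbk[V]$ are regarded as functions $\overline V\to\overline{\Bbbk}$. A subalgebra $A\subseteq\Bbbk[V]^G$ is a geometric separating algebra if for all $u,v\in\overline V$: $f(u)=f(v)$ for all $f\in\Bbbk[V]^G$ if and only if $h(u)=h(v)$ for all $h\in A$. A reflection is an element of $G$ acting on $V$ so as to fix (pointwise) a subspace of codimension $1$ in $V$; ''the action is generated by reflections'' means the image of $G$ in $GL(V)$ is generated by the images of such elements. *)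

(* Defs.v *)
From HB Require Import structures.
From mathcomp Require Import all_boot all_order all_algebra all_fingroup.
From mathcomp Require Import mxrepresentation.
From mathcomp Require Import mpoly.
Set Implicit Arguments. Unset Strict Implicit. Unset Printing Implicit Defensive.
Import GRing.Theory.
Local Open Scope ring_scope.

(* k[V] is modelled as {mpoly k[n]}, the polynomial ring on the coordinate
   functions of V = k^n (row vectors); G acts on V through a matrix
   representation rG : mx_representation k G n, v |-> v *m rG g. *)

(* the linear substitution X_j |-> sum_i M i j X_i, i.e. f |-> f o (u |-> u *m M) *)
Definition lin_subst (k : fieldType) (n : nat) (M : 'M[k]_n) :
    n.-tuple {mpoly k[n]} :=
  [tuple \sum_(i < n) M i j *: 'X_i | j < n].

Definition invariant (k : fieldType) (gT : finGroupType) (G : {group gT})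
    (n : nat) (rG : mx_representation k G n) (f : {mpoly k[n]}) : Prop :=
  forall g, g \in G -> comp_mpoly (lin_subst (rG g)) f = f.

Definition evalL (k : fieldType) (L : fieldType) (iota : {rmorphism k -> L})
    (n : nat) (f : {mpoly k[n]}) (u : 'rV[L]_n) : L :=
  meval (fun i => u 0 i) (map_mpoly iota f).

Definition is_algebraic_closure (k : fieldType) (L : closedFieldType)
    (iota : {rmorphism k -> L}) : Prop :=
  forall x : L, exists p : {poly k}, p != 0 /\ root (map_poly iota p) x.

Definition polynomial_subalgebra (k : fieldType) (n : nat)
    (A : {mpoly k[n]} -> Prop) : Prop :=
  exists (m : nat) (f : m.-tuple {mpoly k[n]}),
    (forall p : {mpoly k[m]}, comp_mpoly f p = 0 -> p = 0) /\
    (forall h, A h <-> exists p : {mpoly k[m]}, h = comp_mpoly f p).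

Definition geometric_separating (k : fieldType) (gT : finGroupType)
    (G : {group gT}) (n : nat) (rG : mx_representation k G n)
    (L : fieldType) (iota : {rmorphism k -> L})
    (A : {mpoly k[n]} -> Prop) : Prop :=
  (forall h, A h -> invariant rG h) /\
  forall u v : 'rV[L]_n,
    (forall f, invariant rG f -> evalL iota f u = evalL iota f v) <->
    (forall h, A h -> evalL iota h u = evalL iota h v).

(* g acts as a reflection: its fixed space in V has codimension 1 *)
Definition is_reflection (k : fieldType) (gT : finGroupType) (G : {group gT})
    (n : nat) (rG : mx_representation k G n) (g : gT) : bool :=
  (g \in G) && (\rank (rG g - 1%:M) == 1%N).

(* the image of G in GL(V) is generated by the images of reflections *)
Definition generated_by_reflections (k : fieldType) (gT : finGroupType)
    (G : {group gT}) (n : nat) (rG : mx_representation k G n) : Prop :=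
  forall g, g \in G ->
    exists2 r, r \in <<[set x in G | is_reflection rG x]>>%g & rG r = rG g.

(* Main.v *)
Require Import Defs.
From HB Require Import structures.
From mathcomp Require Import all_boot all_order all_algebra all_fingroup.
From mathcomp Require Import mxrepresentation.
From mathcomp Require Import mpoly.
From mathcomp Require Import zify ring.
From mathcomp Require classical_sets.
From Stdlib Require Import Classical.
Set Implicit Arguments. Unset Strict Implicit. Unset Printing Implicit Defensive.
Import GRing.Theory.
Local Open Scope ring_scope.

(** If f_1, ..., f_m generate A, then m <= n, and the equations
    f_j(x) = f_j(y) cut out in V x V the union of the graphs of the elements of
    G. Such a set-theoretic complete intersection is connected in codimension
    one, and two graphs meet in codimension one exactly when they differ by a
    reflection. Connectedness is proved by Hartshorne's argument. If the graphs
    split into two families meeting in codimension at least two, there are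
    coprime products a, b of linear forms in x that vanish on the intersection of
    the two families, and it suffices to know that b is a nonzerodivisor modulo
    a in R = L[x, y] / (f_j(x) - f_j(y)). This follows from the vanishing of the
    first Koszul homology of the f_j(x) - f_j(y) on L[x, y] / (a, b): by the
    Nullstellensatz, a power of prod_g (y_i - (x g)_i) lies in the ideal
    (f_j(x) - f_j(y)) for every i <= n, these n elements form a regular sequence
    modulo (a, b), and the length m of the Koszul complex is at most n. *)

(** * Koszul complexes *)

Definition is_ideal (R : comNzRingType) (I : R -> Prop) : Prop :=
  [/\ I 0, forall x y, I x -> I y -> I (x + y) & forall r x, I x -> I (r * x)].

Section Ideals.
Variable R : comNzRingType.
Implicit Types (I : R -> Prop) (g c : nat -> R) (i j m : nat).

Lemma ideal0 I : is_ideal I -> I 0. Proof. by case. Qed.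

Lemma idealD I x y : is_ideal I -> I x -> I y -> I (x + y).
Proof. by case=> _ HD _; apply: HD. Qed.

Lemma idealM I r x : is_ideal I -> I x -> I (r * x).
Proof. by case=> _ _; apply. Qed.

Lemma idealN I x : is_ideal I -> I x -> I (- x).
Proof. by move=> hI Ix; rewrite -mulN1r; apply: idealM. Qed.

Lemma idealB I x y : is_ideal I -> I x -> I y -> I (x - y).
Proof. by move=> hI Ix Iy; apply: idealD => //; apply: idealN. Qed.

Lemma ideal_sum I (T : Type) (s : seq T) (P : pred T) (F : T -> R) :
  is_ideal I -> (forall t, P t -> I (F t)) -> I (\sum_(t <- s | P t) F t).
Proof.
move=> hI hF; elim/big_rec: _ => [|t x Pt Ix]; first exact: ideal0.
by apply: idealD => //; apply: hF.
Qed.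

Definition nzd_mod I a : Prop := forall x, I (a * x) -> I x.

Definition ideal_adjoin I a : R -> Prop := fun x => exists v, I (x - a * v).

Lemma ideal_adjoinP I a : is_ideal I -> is_ideal (ideal_adjoin I a).
Proof.
move=> hI; split; first by exists 0; rewrite mulr0 subr0; apply: ideal0.
- move=> x y [u Iu] [v Iv]; exists (u + v).
  by rewrite mulrDr opprD addrACA; apply: idealD.
- move=> r x [u Iu]; exists (r * u).
  by rewrite mulrCA -mulrBr; apply: idealM.
Qed.

Definition ideal_span m g : R -> Prop :=
  fun x => exists c : nat -> R, x = \sum_(j < m) c j * g j.

Lemma ideal_spanP m g : is_ideal (ideal_span m g).
Proof.
split.
- by exists (fun=> 0); rewrite big1 // => j _; rewrite mul0r.
- move=> x y [c ->] [d ->]; exists (fun j => c j + d j).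
  by rewrite -big_split /=; apply: eq_bigr => j _; rewrite mulrDl.
- move=> r x [c ->]; exists (fun j => r * c j).
  by rewrite mulr_sumr; apply: eq_bigr => j _; rewrite mulrA.
Qed.

Definition span2 a b : R -> Prop := fun x => exists u v, x = a * u + b * v.

Lemma span2P a b : is_ideal (span2 a b).
Proof.
split.
- by exists 0, 0; rewrite !mulr0 addr0.
- move=> x y [u [v ->]] [u' [v' ->]]; exists (u + u'), (v + v').
  by rewrite !mulrDr addrACA.
- by move=> r x [u [v ->]]; exists (r * u), (r * v); rewrite mulrDr !(mulrCA r).
Qed.

End Ideals.

Section Koszul.
Variable R : comNzRingType.
Implicit Types (I J : R -> Prop) (g c : nat -> R) (i j m : nat).

(* The exterior algebra on e_0, ..., e_(m-1): the pair (u, v) stands for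
   u + e_m v. *)
Fixpoint kos (m : nat) : lmodType R :=
  if m is m'.+1 then (kos m' * kos m')%type else R^o.

Definition kfst m (z : kos m.+1) : kos m := z.1.
Definition ksnd m (z : kos m.+1) : kos m := z.2.
Definition kpair m (u v : kos m) : kos m.+1 := (u, v).
Arguments kfst : simpl never.
Arguments ksnd : simpl never.
Arguments kpair : simpl never.

(** The Koszul differential, that is, contraction against [g]; the signs follow d(e_m v) = g_m v -
    e_m d(v). *)
Fixpoint kd g m : kos m -> kos m :=
  match m with
  | 0 => fun=> 0
  | m'.+1 => fun z => kpair (kd g (kfst z) + g m' *: ksnd z) (- kd g (ksnd z))
  end.

(** Left multiplication by the one-form sum_j c_j e_j; moving it past e_m produces the minus
    sign. *)
Fixpoint kwedge c m : kos m -> kos m :=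
  match m with
  | 0 => fun=> 0
  | m'.+1 => fun z =>
      kpair (kwedge c (kfst z)) (c m' *: kfst z - kwedge c (ksnd z))
  end.

Fixpoint khom m i : kos m -> Prop :=
  match m with
  | 0 => fun z => i = 0%N \/ z = 0
  | m'.+1 => fun z => khom i (kfst z) /\
                     (if i is i'.+1 then khom i' (ksnd z) else ksnd z = 0)
  end.

Fixpoint kin I m : kos m -> Prop :=
  match m with
  | 0 => I
  | m'.+1 => fun z => kin I (kfst z) /\ kin I (ksnd z)
  end.

Fixpoint kone m : kos m :=
  match m with 0 => 1 : R | m'.+1 => kpair (kone m') 0 end.

Lemma kos_eq m (z w : kos m.+1) : kfst z = kfst w -> ksnd z = ksnd w -> z = w.
Proof. by case: z w => [? ?] [? ?]; rewrite /kfst /ksnd /= => -> ->. Qed.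

Lemma kfstD m (z w : kos m.+1) : kfst (z + w) = kfst z + kfst w.
Proof. by []. Qed.
Lemma ksndD m (z w : kos m.+1) : ksnd (z + w) = ksnd z + ksnd w.
Proof. by []. Qed.
Lemma kfstN m (z : kos m.+1) : kfst (- z) = - kfst z.
Proof. by []. Qed.
Lemma ksndN m (z : kos m.+1) : ksnd (- z) = - ksnd z.
Proof. by []. Qed.
Lemma kfstZ m r (z : kos m.+1) : kfst (r *: z) = r *: kfst z.
Proof. by []. Qed.
Lemma ksndZ m r (z : kos m.+1) : ksnd (r *: z) = r *: ksnd z.
Proof. by []. Qed.
Lemma kfst_pair m (u v : kos m) : kfst (kpair u v) = u.
Proof. by []. Qed.
Lemma ksnd_pair m (u v : kos m) : ksnd (kpair u v) = v.
Proof. by []. Qed.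

Lemma kdS g m (z : kos m.+1) :
  kd g z = kpair (kd g (kfst z) + g m *: ksnd z) (- kd g (ksnd z)).
Proof. by []. Qed.

Lemma kwedgeS c m (z : kos m.+1) :
  kwedge c z = kpair (kwedge c (kfst z)) (c m *: kfst z - kwedge c (ksnd z)).
Proof. by []. Qed.

Definition kosE := (kdS, kwedgeS, kfstD, ksndD, kfstN, ksndN, kfstZ, ksndZ,
  kfst_pair, ksnd_pair).

Lemma kd_linear g m (r : R) (u v : kos m) :
  kd g (r *: u + v) = r *: kd g u + kd g v.
Proof.
elim: m u v => [|m IH] u v; first by rewrite /= scaler0 addr0.
apply: kos_eq; rewrite !kosE IH.
- by rewrite !scalerDr !scalerA [g m * r]mulrC addrACA.
- by rewrite scalerN opprD.
Qed.

Lemma kd0 g m : kd g (0 : kos m) = 0.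
Proof. by rewrite -[0 in LHS]addr0 -{1}[0](scaler0 _ (-1 : R)) kd_linear scaleN1r addNr. Qed.

Lemma kdD g m (u v : kos m) : kd g (u + v) = kd g u + kd g v.
Proof. by rewrite -[u in LHS]scale1r kd_linear scale1r. Qed.

Lemma kdZ g m r (u : kos m) : kd g (r *: u) = r *: kd g u.
Proof. by rewrite -[r *: u]addr0 kd_linear kd0 addr0. Qed.

Lemma kdN g m (u : kos m) : kd g (- u) = - kd g u.
Proof. by rewrite -!scaleN1r kdZ. Qed.

Lemma kdB g m (u v : kos m) : kd g (u - v) = kd g u - kd g v.
Proof. by rewrite kdD kdN. Qed.

Lemma kwedge_linear c m (r : R) (u v : kos m) :
  kwedge c (r *: u + v) = r *: kwedge c u + kwedge c v.
Proof.
elim: m u v => [|m IH] u v; first by rewrite /= scaler0 addr0.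
apply: kos_eq; rewrite !kosE IH //.
by rewrite scalerBr scalerDr opprD !scalerA [c m * r]mulrC addrACA.
Qed.

Lemma kwedge0 c m : kwedge c (0 : kos m) = 0.
Proof.
by rewrite -[0 in LHS]addr0 -{1}[0](scaler0 _ (-1 : R)) kwedge_linear scaleN1r addNr.
Qed.

Lemma kwedgeD c m (u v : kos m) : kwedge c (u + v) = kwedge c u + kwedge c v.
Proof. by rewrite -[u in LHS]scale1r kwedge_linear scale1r. Qed.

Lemma kwedgeZ c m r (u : kos m) : kwedge c (r *: u) = r *: kwedge c u.
Proof. by rewrite -[r *: u]addr0 kwedge_linear kwedge0 addr0. Qed.

Lemma kwedgeN c m (u : kos m) : kwedge c (- u) = - kwedge c u.
Proof. by rewrite -!scaleN1r kwedgeZ. Qed.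

Lemma kdK g m (z : kos m) : kd g (kd g z) = 0.
Proof.
elim: m z => [|m IH] z //; apply: kos_eq; rewrite !kosE.
- by rewrite kdD kdZ IH add0r scalerN subrr.
- by rewrite kdN IH !oppr0.
Qed.

(** Contraction is an antiderivation of the exterior algebra, so its anticommutator with a one-form
    is the scalar obtained by contracting that form. *)
Lemma kd_kwedge g c m (z : kos m) :
  kd g (kwedge c z) + kwedge c (kd g z) = (\sum_(j < m) c j * g j) *: z.
Proof.
elim: m z => [|m IH] z; first by rewrite /= big_ord0 scale0r addr0.
rewrite big_ord_recr scalerDl.
apply: kos_eq; rewrite !kosE /= -IH.
- rewrite kwedgeD kwedgeZ scalerBr scalerA addrACA [c m * _]mulrC.
  by rewrite [X in _ + X]subrK.
- rewrite kdB kdZ kwedgeN opprB opprK scalerDr scalerA.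
  by rewrite -[X in _ + X = _]addrA [LHS]addrA subrK addrA addrAC.
Qed.

Lemma khom0 m i : khom i (0 : kos m).
Proof. by elim: m i => [|m IH] i /=; [right | case: i => [|i]; split]. Qed.

Lemma khomD m i (u v : kos m) : khom i u -> khom i v -> khom i (u + v).
Proof.
elim: m i u v => [|m IH] i u v /=.
  by case=> [->|->]; [left | rewrite add0r].
case: i => [|i] [hu1 hu2] [hv1 hv2]; rewrite !kosE; split; try exact: IH.
by rewrite hu2 hv2 addr0.
Qed.

Lemma khomZ m i r (u : kos m) : khom i u -> khom i (r *: u).
Proof.
elim: m i u => [|m IH] i u /=; first by case=> ->; [left | right; rewrite scaler0].
case: i => [|i] [hu1 hu2]; rewrite !kosE; split; try exact: IH.
by rewrite hu2 scaler0.
Qed.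

Lemma khom_kwedge c m i (z : kos m) : khom i z -> khom i.+1 (kwedge c z).
Proof.
elim: m i z => [|m IH] i z /=; first by right.
case=> h1 h2; rewrite !kosE; split; first exact: IH.
apply: khomD; first exact: khomZ.
rewrite -scaleN1r; apply: khomZ.
by case: i h2 {h1} => [->|i h2]; [rewrite kwedge0; apply: khom0 | apply: IH].
Qed.

Lemma khom_gt m i (z : kos m) : (m < i)%N -> khom i z -> z = 0.
Proof.
elim: m i z => [|m IH] [|i] z //= lt_mi; first by case.
case=> h1 h2; apply: kos_eq; first by apply: IH h1; apply: ltnW.
exact: IH h2.
Qed.

Lemma khom_kone m : khom 0 (kone m).
Proof. by elim: m => [|m IH] /=; [left | split]. Qed.

Lemma koneS m : kone m.+1 = kpair (kone m) 0.
Proof. by []. Qed.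

Lemma kd_kone g m : kd g (kone m) = 0.
Proof.
elim: m => [|m IH] //; apply: kos_eq; rewrite koneS !kosE.
  by rewrite IH scaler0 addr0.
by rewrite kd0 oppr0.
Qed.

Lemma kin0 I m : is_ideal I -> kin I (0 : kos m).
Proof. by move=> hI; elim: m => [|m IH] /=; [apply: ideal0 | split]. Qed.

Lemma kinD I m (u v : kos m) : is_ideal I -> kin I u -> kin I v -> kin I (u + v).
Proof.
move=> hI; elim: m u v => [|m IH] u v /=; first exact: idealD.
by case=> hu1 hu2 [hv1 hv2]; rewrite !kosE; split; apply: IH.
Qed.

Lemma kinZ I m r (u : kos m) : is_ideal I -> kin I u -> kin I (r *: u).
Proof.
move=> hI; elim: m u => [|m IH] u /=; first exact: idealM.
by case=> hu1 hu2; rewrite !kosE; split; apply: IH.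
Qed.

Lemma kinN I m (u : kos m) : is_ideal I -> kin I u -> kin I (- u).
Proof. by move=> hI hu; rewrite -scaleN1r; apply: kinZ. Qed.

Lemma kinB I m (u v : kos m) : is_ideal I -> kin I u -> kin I v -> kin I (u - v).
Proof. by move=> hI hu hv; apply: kinD => //; apply: kinN. Qed.

Lemma kin_kwedge I c m (u : kos m) : is_ideal I -> kin I u -> kin I (kwedge c u).
Proof.
move=> hI; elim: m u => [|m IH] u /=; first by move=> _; apply: ideal0.
case=> hu1 hu2; rewrite !kosE; split; first exact: IH.
by apply: kinB => //; [apply: kinZ | apply: IH].
Qed.

Lemma kin_scale I J m r (u : kos m) :
  (forall x, I x -> J (r * x)) -> kin I u -> kin J (r *: u).
Proof.
move=> hIJ; elim: m u => [|m IH] u /=; first exact: hIJ.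
by case=> hu1 hu2; rewrite !kosE; split; apply: IH.
Qed.

Lemma kin_kd I J g m (u : kos m) : is_ideal J ->
  (forall j x, (j < m)%N -> I x -> J (g j * x)) -> kin I u -> kin J (kd g u).
Proof.
move=> hJ; elim: m u => [|m IH] u /= hIJ; first by move=> _; apply: ideal0.
have hIJ' j x : (j < m)%N -> I x -> J (g j * x).
  by move=> lt_jm; apply: hIJ; apply: ltnW.
case=> hu1 hu2; rewrite !kosE; split; last by apply: kinN => //; apply: IH.
by apply: kinD => //; [apply: IH | apply: kin_scale hu2 => x; apply: hIJ].
Qed.

Lemma kin_adjoin I a m (u : kos m) :
  kin (ideal_adjoin I a) u -> exists v : kos m, kin I (u - a *: v).
Proof.
elim: m u => [|m IH] u /=; first by case=> v hv; exists v.
case=> /IH[v1 h1] /IH[v2 h2]; exists (kpair v1 v2).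
by split; rewrite !kosE.
Qed.

Lemma kin_nzd I a m (u : kos m) : nzd_mod I a -> kin I (a *: u) -> kin I u.
Proof.
move=> ha; elim: m u => [|m IH] u /=; first exact: ha.
by case; rewrite !kosE => h1 h2; split; apply: IH.
Qed.

(** Vanishing of the degree [i] Koszul homology of [g] over R/I, expressed through representatives
    in [R]. *)
Definition kacyclic I g m i : Prop :=
  forall z : kos m, khom i z -> kin I (kd g z) -> exists w, kin I (z - kd g w).

(* Multiplication by an element a of the ideal (g) is null-homotopic on the
   Koszul complex. *)
Lemma kacyclic_adjoin I g m a i : is_ideal I -> nzd_mod I a ->
  ideal_span m g a -> kacyclic (ideal_adjoin I a) g m i.+1 -> kacyclic I g m i.
Proof.
move=> hI ha [c def_a] acy z hz dz.
have kdI (u : kos m) : kin I u -> kin I (kd g u).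
  by apply: kin_kd => // j x _; apply: idealM.
have kaI (u : kos m) : kin I u -> kin (ideal_adjoin I a) u.
  elim: (m) u => [|m' IH] u /=; first by exists 0; rewrite mulr0 subr0.
  by case=> h1 h2; split; apply: IH.
have homotopy := kd_kwedge g c z; rewrite -def_a in homotopy.
have hdz : kin I (kwedge c (kd g z)) by apply: kin_kwedge.
(* Modulo [I] and [a], the wedge of [c] with [z] is a cycle of degree [i.+1], so modulo [I] it has
   the form d(w) + a v. *)
have [|w /kin_adjoin[v hv]] := acy _ (khom_kwedge c hz).
  have -> : kd g (kwedge c z) = a *: z - kwedge c (kd g z).
    by rewrite -homotopy addrK.
  apply: kinB; first exact: ideal_adjoinP.
    apply: kin_scale (_ : kin (fun=> True) z) => [x _|].
      by exists x; rewrite subrr; apply: ideal0.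
    by elim: (m) (z) => [|m' IH] //= u; split.
  exact: kaI.
(* Applying d to that relation puts a (z - d(v)) in [I], and [a] can be cancelled. *)
exists v; apply: (kin_nzd ha).
have -> : a *: (z - kd g v) =
    kwedge c (kd g z) + kd g (kwedge c z - kd g w - a *: v).
  by rewrite !kdB kdK subr0 kdZ scalerBr -homotopy [_ + kwedge _ _]addrC addrA.
by apply: kinD => //; apply: kdI.
Qed.

(** Descending induction with [kacyclic_adjoin]: once all [n] elements are adjoined, degree n + 1
    exceeds [m] and contains only 0; each element removed lowers the degree by one, down to degree 1
    over [Q 0]. *)
Lemma kacyclic_regular (Q : nat -> R -> Prop) (N : nat -> R) g m n :
  (m <= n)%N -> is_ideal (Q 0%N) ->
  (forall j, Q j.+1 = ideal_adjoin (Q j) (N j)) ->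
  (forall j, (j < n)%N -> nzd_mod (Q j) (N j)) ->
  (forall j, (j < n)%N -> ideal_span m g (N j)) ->
  kacyclic (Q 0%N) g m 1.
Proof.
move=> le_mn hQ0 hQS hnzd hspan.
have hQ j : is_ideal (Q j).
  by elim: j => // j IH; rewrite hQS; apply: ideal_adjoinP.
suff acy k : (k <= n)%N -> kacyclic (Q (n - k)%N) g m (n - k).+1.
  by rewrite -[0%N](subnn n); apply: acy.
elim: k => [|k IH] le_kn.
  rewrite subn0 => z hz _; exists 0.
  by rewrite kd0 subr0 (khom_gt _ hz) ?ltnS //; apply: kin0.
have lt_nk : (n - k.+1 < n)%N by rewrite ltn_subrL; apply: leq_ltn_trans le_kn.
have defk : (n - k = (n - k.+1).+1)%N by rewrite -subSn // subSS.
apply: (kacyclic_adjoin (a := N (n - k.+1)%N)) => //; first exact: hnzd.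
  exact: hspan.
by rewrite -hQS -defk; apply: IH; apply: ltnW.
Qed.

(** A sum in [I] makes the one-form [h] a cycle modulo [I], so [h] is d(w) plus a form with
    coefficients in [I]. As d(d(w)) = 0, the sum is d of the latter form. This shows that an element
    of (g) lying in [I] lies in the product of [I] and (g). *)
Lemma kacyclic_relation I J g m (h : nat -> R) :
  is_ideal I -> is_ideal J -> kacyclic I g m 1 ->
  (forall j x, (j < m)%N -> I x -> J (g j * x)) ->
  I (\sum_(j < m) h j * g j) -> J (\sum_(j < m) h j * g j).
Proof.
move=> hI hJ acy hIJ Ih; set x := \sum_(j < m) _ in Ih *.
have defx : kd g (kwedge h (kone m)) = x *: kone m.
  by rewrite -(kd_kwedge g) kd_kone kwedge0 addr0.
have one_gen (K : R -> Prop) y : is_ideal K -> K y <-> kin K (y *: kone m).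
  move=> hK; elim: (m) => [|m' IH]; first by rewrite /= /GRing.scale /= mulr1.
  rewrite koneS /= !kosE; split=> [/IH hy|[/IH]] //; split=> //.
  by rewrite scaler0; apply: kin0.
have [|w hw] := acy _ (khom_kwedge h (khom_kone m)).
  by rewrite defx -one_gen.
rewrite (one_gen J) // -defx.
have -> : kd g (kwedge h (kone m)) = kd g (kwedge h (kone m) - kd g w).
  by rewrite kdB kdK subr0.
exact: kin_kd hw.
Qed.

End Koszul.

(** * The Nullstellensatz *)

Definition prime_ideal (R : comNzRingType) (p : R -> Prop) : Prop :=
  [/\ is_ideal p, ~ p 1 & forall x y, p (x * y) -> p x \/ p y].

(** The extended ideal I[X] of R[X]. *)
Definition coefs_in (R : comNzRingType) (I : R -> Prop) (F : {poly R}) : Prop :=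
  forall i, I F`_i.

Lemma prime_idealX (R : comNzRingType) (p : R -> Prop) x n :
  prime_ideal p -> p (x ^+ n) -> p x.
Proof.
case=> hp p1 pM; elim: n => [|n IH]; first by rewrite expr0.
by rewrite exprS => /pM[].
Qed.

Lemma exists_min (P : nat -> Prop) n :
  P n -> exists m, P m /\ forall k, P k -> (m <= k)%N.
Proof.
elim/ltn_ind: n => n IH Pn.
have [[k [lt_kn Pk]]|nex] := classic (exists k, (k < n)%N /\ P k).
  exact: IH Pk.
exists n; split=> // k Pk; rewrite leqNgt; apply/negP => lt_kn.
by apply: nex; exists k.
Qed.

(** * Polynomials modulo an extended ideal *)

Section PolyIdeal.
Variables (S : comNzRingType) (I : S -> Prop).
Hypothesis hI : is_ideal I.

Lemma coefs_in_ideal : is_ideal (coefs_in I).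
Proof.
split=> [i|F G hF hG i|F G hG i]; first by rewrite coef0; apply: ideal0.
  by rewrite coefD; apply: idealD.
by rewrite coefM; apply: ideal_sum => // j _; apply: idealM.
Qed.

(** Descending induction on the coefficients of [F]: once the higher ones are in [I], the
    coefficient of N F in degree deg N + i is [lead_coef N] times that of [F] in degree [i], modulo
    [I]. *)
Lemma coefs_in_nzd (N : {poly S}) :
  nzd_mod I (lead_coef N) -> nzd_mod (coefs_in I) N.
Proof.
move=> hN F hNF.
suff coefF k i : (size F <= i + k)%N -> I F`_i.
  by move=> i; apply: (coefF (size F)); apply: leq_addl.
elim: k i => [|k IH] i le_F.
  by rewrite nth_default; [apply: ideal0 | rewrite addn0 in le_F].
apply: hN; set e := (size N).-1.
have := hNF (e + i)%N; rewrite coefM.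
have lt_e : (e < (e + i).+1)%N by rewrite ltnS leq_addr.
rewrite (bigD1 (Ordinal lt_e)) //= addKn.
set s := (X in _ + X) => h.
rewrite -[_ * _](addrK s); apply: idealB => //.
apply: ideal_sum => // j; rewrite -val_eqE /= => ne_je.
have [lt_je|le_ej] := ltnP j e.
  by apply: idealM => //; apply: IH; lia.
rewrite [N`_j]nth_default; first by rewrite mul0r; apply: ideal0.
by apply: leq_trans (leqSpred _) _; rewrite -/e ltn_neqAle eq_sym ne_je.
Qed.

(** Leading terms with coefficient in [I] are stripped off one at a time. *)
Lemma coefs_in_trunc (F : {poly S}) : ~ coefs_in I F ->
  exists F', [/\ coefs_in I (F - F'), (size F' <= size F)%N & ~ I (lead_coef F')].
Proof.
have [n] := ubnP (size F); elim: n F => // n IH F /ltnSE le_Fn nF.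
have [hl|] := classic (I (lead_coef F)); last first.
  by exists F; split=> //; rewrite subrr; apply: ideal0 coefs_in_ideal.
have nzF : F != 0.
  by apply/eqP => F0; apply: nF; rewrite F0; apply: ideal0 coefs_in_ideal.
pose T := lead_coef F *: 'X ^+ (size F).-1 : {poly S}.
have hT : coefs_in I T.
  by move=> i; rewrite coefZ mulrC; apply: idealM.
have lt_FT : (size (F - T)%R < size F)%N.
  rewrite [X in (_ < X)%N](polySpred nzF) ltnS; apply/leq_sizeP => j.
  rewrite leq_eqVlt coefB coefZ coefXn => /orP[/eqP<-|lt_j].
    by rewrite eqxx mulr1 subrr.
  rewrite gtn_eqF // mulr0 subr0 nth_default //.
  by apply: leq_trans (leqSpred _) lt_j.
have [||F' [h1 h2 h3]] := IH (F - T); first exact: leq_trans le_Fn.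
  move=> hFT; apply: nF; rewrite -(subrK T F).
  exact: idealD coefs_in_ideal _ _.
exists F'; split=> //; last exact: leq_trans h2 (ltnW lt_FT).
have -> : F - F' = F - T - F' + T by rewrite addrAC subrK.
exact: idealD coefs_in_ideal _ _.
Qed.

(* Modulo I, a polynomial of least degree in D generates D up to a power of its
   leading coefficient. *)
Lemma pseudo_generator (D : {poly S} -> Prop) :
  is_ideal D -> (forall F, coefs_in I F -> D F) ->
  (exists2 F, D F & ~ coefs_in I F) ->
  exists d, [/\ D d, ~ I (lead_coef d) &
    forall F, D F -> exists r w, coefs_in I (lead_coef d ^+ r *: F - w * d)].
Proof.
move=> hD ID [F0 DF0 nF0].
pose Q n := exists d, [/\ D d, ~ I (lead_coef d) & size d = n].
have Qtrunc F : D F -> ~ coefs_in I F -> exists n, Q n /\ (n <= size F)%N.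
  move=> DF /coefs_in_trunc[F' [h1 h2 h3]]; exists (size F'); split=> //.
  exists F'; split=> //; rewrite -[F'](subKr F); apply: idealB => //.
  exact: ID.
have [n0 [Qn0 _]] := Qtrunc _ DF0 nF0.
have [_ [[d [Dd nd <-]] dmin]] := exists_min Qn0.
exists d; split=> // F DF.
exists (Pdiv.CommonRing.rscalp F d), (Pdiv.CommonRing.rdivp F d).
have -> : lead_coef d ^+ Pdiv.CommonRing.rscalp F d *: F -
    Pdiv.CommonRing.rdivp F d * d = Pdiv.CommonRing.rmodp F d.
  by rewrite Pdiv.ComRing.rdivp_eq [_ + Pdiv.CommonRing.rmodp F d]addrC addrK.
(* The remainder lies in [D]; outside I[X], its truncation would be smaller than the minimal [d]. *)
apply: NNPP => /(Qtrunc _) [|n [Qn le_n]].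
  have -> : Pdiv.CommonRing.rmodp F d =
    lead_coef d ^+ Pdiv.CommonRing.rscalp F d *: F - Pdiv.CommonRing.rdivp F d * d.
    by rewrite Pdiv.ComRing.rdivp_eq [_ + Pdiv.CommonRing.rmodp F d]addrC addrK.
  by apply: idealB => //; [rewrite -mul_polyC|]; apply: idealM.
have := leq_trans (dmin _ Qn) le_n; rewrite leqNgt.
rewrite Pdiv.CommonRing.ltn_rmodp; case: eqP => // d0 _.
by apply: nd; rewrite d0 lead_coef0; apply: ideal0.
Qed.

End PolyIdeal.

(** * Extension of points to one more variable *)

Section PrimeExtension.
Variables (S : comNzRingType) (L : closedFieldType).
Variable p : {poly S} -> Prop.
Hypothesis hp : prime_ideal p.
Let pI : is_ideal p. Proof. by case: hp. Qed.
Let q x := p x%:P.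

Lemma contraction_prime : prime_ideal q.
Proof.
case: hp => _ p1 pM; split; last by move=> x y; rewrite /q polyCM => /pM.
  split; first by rewrite /q polyC0; apply: ideal0.
    by move=> x y; rewrite /q polyCD; apply: idealD.
  by move=> r x; rewrite /q polyCM; apply: idealM.
by rewrite /q polyC1.
Qed.

Let qI : is_ideal q. Proof. by case: contraction_prime. Qed.

Lemma coefs_in_contraction F : coefs_in q F -> p F.
Proof.
move=> hF; rewrite -[F]coefK poly_def; apply: ideal_sum => // i _.
by rewrite -mul_polyC mulrC; apply: idealM => //; apply: hF.
Qed.

Lemma prime_nzd x : ~ q x -> nzd_mod q x.
Proof. by case: contraction_prime => _ _ qM nx y /qM[]. Qed.

(** The induction step of the Nullstellensatz. When [p] is not extended from [q], [a] collects the
    leading coefficients that must stay nonzero for pseudo-division to survive the specialization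
    [phi]. *)
Lemma prime_extension b : ~ p b -> exists2 a, ~ q a &
  forall phi : {rmorphism S -> L}, (forall x, q x -> phi x = 0) -> phi a != 0 ->
  exists c, (forall F, p F -> (map_poly phi F).[c] = 0) /\
            (map_poly phi b).[c] != 0.
Proof.
move=> nb.
have map0 (phi : {rmorphism S -> L}) F : (forall x, q x -> phi x = 0) ->
    coefs_in q F -> map_poly phi F = 0.
  by move=> hphi hF; apply/polyP => i; rewrite coef_map coef0; apply: hphi.
(* If p = q[X], some coefficient of [b] is outside [q]; where it does not vanish, any non-root of
   the specialized [b] serves. *)
have [[F0 pF0 nF0]|pq] := classic (exists2 F, p F & ~ coefs_in q F); last first.
  have {}pq F : p F -> coefs_in q F by move=> pF; apply: NNPP => nF; case: pq; exists F.
  have [i nbi] : exists i, ~ q b`_i.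
    by apply: not_all_ex_not => /coefs_in_contraction.
  exists b`_i => // phi hphi nz_b.
  have /closed_nonrootP[c nroot] : map_poly phi b != 0.
    by apply: contraNneq nz_b => b0; rewrite -coef_map b0 coef0.
  exists c; split=> [F pF|]; last exact: nroot.
  by rewrite (map0 _ _ hphi) ?horner0 //; apply: pq.
have [|f [pf nlf hf]] := pseudo_generator qI pI coefs_in_contraction.
  by exists F0.
pose D := ideal_adjoin p b.
have DI : is_ideal D by apply: ideal_adjoinP.
have pD F : p F -> D F by move=> pF; exists 0; rewrite mulr0 subr0.
have Db : D b by exists 1; rewrite mulr1 subrr; apply: ideal0.
have [|||d [[u hu] nld hd]] := pseudo_generator (D := D) qI.
- by [].
- by move=> F /coefs_in_contraction/pD.
- by exists b => // /coefs_in_contraction.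
(* Up to powers of leading coefficients and modulo q[X], f = w d. As [d] is not in the prime [p],
   [w] is, so w = v f; cancelling [f] leaves 1 = v d, which is the content of [qe]. *)
have [r [w hw]] := hd f (pD _ pf).
have pwd : p (w * d).
  rewrite -[w * d](subKr (lead_coef d ^+ r *: f)); apply: idealB => //.
    by rewrite -mul_polyC; apply: idealM.
  exact: coefs_in_contraction.
have lead_power F s : p (lead_coef d ^+ s *: F) -> p F.
  case: (hp) => _ _ pM; rewrite -mul_polyC => /pM[] //; rewrite polyC_exp => /(prime_idealX hp).
  by move/nld.
have nd : ~ p d.
  move=> pd; have [s [w' hw']] := hd b Db.
  apply: nb; apply: (lead_power _ s).
  rewrite -(subrK (w' * d) (_ *: b)); apply: idealD => //; last exact: idealM.
  exact: coefs_in_contraction.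
have pw : p w by case: (hp) => _ _ /(_ _ _ pwd)[].
have [t [v hv]] := hf w pw.
pose e : {poly S} := (lead_coef f ^+ t * lead_coef d ^+ r)%:P - v * d.
have qe : coefs_in q e.
  apply: (coefs_in_nzd qI (prime_nzd nlf)).
  have -> : f * e = (lead_coef f ^+ t)%:P * (lead_coef d ^+ r *: f - w * d) +
      d * (lead_coef f ^+ t *: w - v * f).
    by rewrite /e -!mul_polyC polyCM; ring.
  by apply: (idealD (coefs_in_ideal qI)); apply: (idealM _ (coefs_in_ideal qI)).
case: (contraction_prime) => _ q1 qM.
exists (lead_coef f * lead_coef d) => [/qM[]//|phi hphi].
rewrite rmorphM mulf_eq0 negb_or => /andP[nzf nzd].
have szf : size (map_poly phi f) = size f by rewrite size_map_poly_id0.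
(* [f] is in [p] but its leading coefficient is not in [q], so [f] is not constant. *)
have /closed_rootP[c rootc] : size (map_poly phi f) != 1%N.
  rewrite szf; apply/negP => /size_poly1P[x nzx def_f].
  by apply: nlf; rewrite /q; move: pf; rewrite def_f lead_coefC.
exists c.
have p0 F : p F -> (map_poly phi F).[c] = 0.
  move=> pF; have [s [w' /(map0 _ _ hphi)]] := hf F pF.
  rewrite rmorphB rmorphM /= map_polyZ => /eqP; rewrite subr_eq0 => /eqP eF.
  have: (phi (lead_coef f ^+ s) *: map_poly phi F).[c] = 0.
    by rewrite eF hornerM (rootP rootc) mulr0.
  rewrite hornerZ => /eqP; rewrite mulf_eq0 rmorphXn expf_eq0 (negPf nzf) andbF /=.
  by move/eqP.
(* [d] is a multiple of [b] modulo [p], so it would vanish at [c] along with [b], against [qe]. *)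
split=> //; apply/negP => /eqP b0.
have d0 : (map_poly phi d).[c] = 0.
  by have := p0 _ hu; rewrite rmorphB rmorphM hornerD hornerN hornerM b0 mul0r subr0.
have /(congr1 (horner^~ c)) := map0 _ _ hphi qe; rewrite horner0.
rewrite /e polyCM rmorphB !(rmorphM (map_poly phi)) /= !map_polyC /=.
rewrite hornerD hornerN !hornerM d0 mulr0 subr0 !hornerC !rmorphXn.
move=> /eqP; rewrite mulf_eq0 !expf_eq0.
by rewrite (negPf nzf) (negPf nzd) !andbF.
Qed.

End PrimeExtension.

Lemma mpoly_gen_ind (R : nzRingType) N (P : {mpoly R[N]} -> Prop) :
  (forall c, P c%:MP) -> (forall i, P 'X_i) ->
  (forall f g, P f -> P g -> P (f + g)) ->
  (forall f g, P f -> P g -> P (f * g)) -> forall f, P f.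
Proof.
move=> PC PX PD PM f; rewrite [f]mpolyE; elim/big_rec: _ => [|m g _ Pg].
  by rewrite -[0]/(0 : {mpoly R[N]}) -(mpolyC0 N R).
apply: (PD) => //; rewrite -mul_mpolyC; apply: (PM) => //.
rewrite mpolyXE_id; elim/big_rec: _ => [|i h _ Ph]; first exact: PC.
apply: (PM) => //; elim: (m i) => [|k IH]; first exact: PC.
by rewrite exprS; apply: (PM).
Qed.

(** An ideal maximal among those containing [I] and no power of [F], obtained from Zorn's lemma, is
    prime. *)
Lemma exists_prime (R : comNzRingType) (I : R -> Prop) F :
  is_ideal I -> (forall k, ~ I (F ^+ k)) ->
  exists p, [/\ prime_ideal p, forall x, I x -> p x & ~ p F].
Proof.
move=> hI nI.
pose good (J : R -> Prop) :=
  [/\ is_ideal J, forall x, I x -> J x & forall k, ~ J (F ^+ k)].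
have [C chainC totC|p [goodp maxp]] :=
    @classical_sets.Zorn_bigcup R (fun J => (forall x, ~ J x) \/ good J).
  have [[J CJ gJ]|nC] := classic (exists2 J, C J & good J); last first.
    left=> x [J CJ Jx]; have [/(_ x)//|gJ] := chainC _ CJ.
    by apply: nC; exists J.
  right; have goodC K x : C K -> K x -> good K.
    by move=> CK Kx; have [/(_ x)|] := chainC _ CK.
  split.
  - split; first by exists J => //; case: gJ => + _ _; apply: ideal0.
      move=> x y [K CK Kx] [K' CK' K'y].
      have [hK _ _] := goodC _ _ CK Kx; have [hK' _ _] := goodC _ _ CK' K'y.
      by have [KK'|K'K] := totC _ _ CK CK'; [exists K'|exists K] => //;
        apply: idealD => //; [apply: KK'|apply: K'K].
    move=> r x [K CK Kx]; have [hK _ _] := goodC _ _ CK Kx.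
    by exists K => //; apply: idealM.
  - by move=> x Ix; exists J => //; case: gJ => _ + _; apply.
  - by move=> k [K CK KF]; have [_ _ /(_ k)] := goodC _ _ CK KF.
have {goodp} [hp Ip nF] : good p.
  case: goodp => // p0; case: (maxp I); last by right; split.
  split=> [x /p0 //|] /(_ 0 (ideal0 hI)); exact: p0.
exists p; split=> //; last by move/(_ 1%N): nF; rewrite expr1.
have adj a : ~ p a -> exists k v, p (F ^+ k - a * v).
  move=> na; apply: NNPP => nk; case: (maxp (ideal_adjoin p a)).
    split=> [x px|]; first by exists 0; rewrite mulr0 subr0.
    move=> /(_ a) h; apply: na; apply: h; exists 1.
    by rewrite mulr1 subrr; apply: ideal0.
  right; split; first exact: ideal_adjoinP.
    by move=> x /Ip px; exists 0; rewrite mulr0 subr0.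
  by move=> k [v hv]; apply: nk; exists k, v.
split=> //; first by move: (nF 0%N); rewrite expr0.
move=> x y pxy; apply: NNPP => /not_or_and[/adj[k [u hu]] /adj[l [v hv]]].
apply: (nF (k + l)%N).
have -> : F ^+ (k + l) = F ^+ l * (F ^+ k - x * u) +
    (x * u * (F ^+ l - y * v) + u * v * (x * y)).
  by rewrite exprD; ring.
by apply: idealD => //; [|apply: idealD => //]; apply: idealM.
Qed.

Section Nullstellensatz.
Variable L : closedFieldType.

(** Primes in N + 1 variables are pulled back along this map, which turns the last variable into the
    one of [prime_extension]. *)
Let glue N (q : {poly {mpoly L[N]}}) : {mpoly L[N.+1]} :=
  (map_poly (@mwiden N L) q).['X_ord_max].

Lemma meval_mwiden N (v : 'I_N.+1 -> L) (F : {mpoly L[N]}) :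
  (mwiden F).@[v] = F.@[fun i => v (widen_ord (leqnSn N) i)].
Proof.
elim/mpoly_gen_ind: F => [c|i|F G IF IG|F G IF IG].
- by rewrite mwidenC !mevalC.
- by rewrite mwidenX mnmwiden1 !mevalXU.
- by rewrite mwidenD !mevalD IF IG.
- by rewrite mwidenM !mevalM IF IG.
Qed.

Lemma meval_glue N (v : 'I_N.+1 -> L) (q : {poly {mpoly L[N]}}) :
  (glue q).@[v] =
  (map_poly (meval (fun i => v (widen_ord (leqnSn N) i))) q).[v ord_max].
Proof.
rewrite /glue -(mevalXU v ord_max) -horner_map -map_poly_comp /=.
by congr (_.[_]); apply: eq_map_poly => F /=; apply: meval_mwiden.
Qed.

Lemma glue_surj N (F : {mpoly L[N.+1]}) : exists q, F = glue q.
Proof.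
elim/mpoly_gen_ind: F => [c|i|_ _ [q ->] [r ->]|_ _ [q ->] [r ->]].
- by exists (c%:MP)%:P; rewrite /glue map_polyC hornerC /= mwidenC.
- case: (unliftP ord_max i) => [j ->|->].
    exists ('X_j)%:P; rewrite /glue map_polyC hornerC /= mwidenX mnmwiden1.
    by congr ('X_ _); apply/val_inj; rewrite /= /bump leqNgt ltn_ord.
  by exists 'X; rewrite /glue map_polyX hornerX.
- by exists (q + r); rewrite /glue rmorphD hornerD.
- by exists (q * r); rewrite /glue rmorphM hornerM.
Qed.

(** Induction on the number of variables: the contraction of [p] has a zero where the [a] of
    [prime_extension] is nonzero, and [c] is the last coordinate. Without variables, [p] is the zero
    ideal of a field. *)
Lemma prime_point N (p : {mpoly L[N]} -> Prop) b : prime_ideal p -> ~ p b ->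
  exists u : 'I_N -> L, (forall F, p F -> F.@[u] = 0) /\ b.@[u] != 0.
Proof.
elim: N p b => [|N IH] p b hp nb.
  have pI : is_ideal p by case: hp.
  have const (F : {mpoly L[0]}) : F = (F@_0%MM)%:MP by exact: nvar0_mpolyC.
  have pc c : p c%:MP -> c = 0.
    move=> pc; apply/eqP/negP => nz_c; case: hp => _ + _; apply.
    have -> : 1 = (c^-1)%:MP * c%:MP :> {mpoly L[0]}.
      by rewrite -mpolyCM mulVf ?mpolyC1 //; apply/negP.
    exact: idealM.
  exists (fun=> 0); split=> [F pF|].
    rewrite (const F) in pF *; rewrite mevalC; exact: pc.
  rewrite (const b) mevalC; apply/eqP => b0; apply: nb.
  by rewrite (const b) b0 mpolyC0; apply: ideal0.
have [b' def_b] := glue_surj b.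
pose p' q := p (glue q).
have hp' : prime_ideal p'.
  case: hp => pI p1 pM; rewrite /p' /glue; split.
  - split; first by rewrite rmorph0 horner0; apply: ideal0.
      by move=> x y; rewrite rmorphD hornerD; apply: idealD.
    by move=> r x; rewrite rmorphM hornerM; apply: idealM.
  - by rewrite rmorph1 hornerC.
  - by move=> x y; rewrite rmorphM hornerM; apply: pM.
have [|a na ext] := prime_extension L hp' (b := b'); first by rewrite /p' -def_b.
have [u [hu nza]] := IH _ _ (contraction_prime hp') na.
have [c [hc nzb]] := ext (meval u) hu nza.
pose v i := if unlift ord_max i is Some j then u j else c.
have vmax : v ord_max = c by rewrite /v unlift_none.
have vwiden : (fun i => v (widen_ord (leqnSn N) i)) =1 u.
  move=> i; have -> : widen_ord (leqnSn N) i = lift ord_max i.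
    by apply/val_inj; rewrite /= /bump leqNgt ltn_ord.
  by rewrite /v liftK.
have evalv q : (glue q).@[v] = (map_poly (meval u) q).[c].
  rewrite meval_glue vmax; congr (_.[_]).
  by apply: eq_map_poly => F; apply: meval_eq.
exists v; split=> [F pF|]; last by rewrite def_b evalv.
by have [q def_F] := glue_surj F; rewrite def_F evalv hc // /p' -def_F.
Qed.

(** If no power of [F] is in [I], some prime contains [I] but not [F], and it has a zero at which
    [F] does not vanish. *)
Theorem nullstellensatz N (I : {mpoly L[N]} -> Prop) F : is_ideal I ->
  (forall u, (forall f, I f -> f.@[u] = 0) -> F.@[u] = 0) ->
  exists k, I (F ^+ k).
Proof.
move=> hI hF; apply: NNPP => nI.
have [k IFk|p [hp Ip nF]] := exists_prime (F := F) hI.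
  by apply: nI; exists k.
have [u [hu /eqP[]]] := prime_point hp nF.
by apply: hF => f /Ip; apply: hu.
Qed.

End Nullstellensatz.

(** * Algebraic independence and separation of orbits *)

Section AlgebraicIndependence.
Variables (k : fieldType) (n : nat).

Lemma msizeM_leq (p q : {mpoly k[n]}) d e :
  (msize p <= d.+1)%N -> (msize q <= e.+1)%N -> (msize (p * q)%R <= (d + e).+1)%N.
Proof.
have [->|nzp] := eqVneq p 0; first by rewrite mul0r msize0.
have [->|nzq] := eqVneq q 0; first by rewrite mulr0 msize0.
rewrite msizeM // => hp hq.
by move: (msize p) (msize q) hp hq => a b; lia.
Qed.

Lemma msize_prod_leq m (f : 'I_m -> {mpoly k[n]}) (e : 'I_m -> nat) d :
  (forall i, msize (f i) <= d.+1)%N ->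
  (msize (\prod_i f i ^+ e i)%R <= (\sum_i e i * d).+1)%N.
Proof.
move=> hf; elim/big_rec2: _ => [|i s p _ IH]; first by rewrite msize1.
apply: msizeM_leq => //; elim: (e i) => [|c IHc]; first by rewrite expr0 msize1.
by rewrite exprS mulSn; apply: msizeM_leq.
Qed.

(* A count of monomials: the B^m monomials in f with exponents below B lie in a
   space of dimension O(B^n). *)
Lemma algebraically_independent_leq m (f : m.-tuple {mpoly k[n]}) :
  (forall p : {mpoly k[m]}, comp_mpoly f p = 0 -> p = 0) -> (m <= n)%N.
Proof.
move=> indep; rewrite leqNgt; apply/negP => lt_nm.
(* [B] exceeds (m d + 1)^n, and monomials of degree at most m B d have all exponents below [C]. As C
   <= (m d + 1) B, one gets C^n < B^(n+1) <= B^m. *)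
pose d := \max_(i < m) msize (tnth f i).
have hd i : (msize (tnth f i) <= d.+1)%N by apply: leqW; apply: leq_bigmax.
pose B := ((m * d).+1 ^ n).+1.
pose C := (m * (B * d)).+1.
have lt_CB : (C ^ n < B ^ m)%N.
  apply: leq_trans (leq_pexp2l (ltn0Sn _) lt_nm).
  rewrite expnS; apply: leq_ltn_trans (_ : (m * d).+1 ^ n * B ^ n < _)%N.
    rewrite -expnMn; have le_C : (C <= (m * d).+1 * B)%N.
      by rewrite /C mulSn mulnCA mulnC -addn1 addnC leq_add.
    by case: (n) => // n'; rewrite leq_exp2r.
  by rewrite ltn_mul2r expn_gt0 /=.
pose row := {ffun 'I_m -> 'I_B}; pose column := {ffun 'I_n -> 'I_C}.
pose rowm (e : row) : 'X_{1..m} := [multinom (e i : nat) | i < m].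
pose colm (h : column) : 'X_{1..n} := [multinom (h i : nat) | i < n].
pose F (e : row) := comp_mpoly f 'X_[rowm e].
pose A := \matrix_(i < #|{: row}|, j < #|{: column}|)
  (F (enum_val i))@_(colm (enum_val j)).
(* [A] has more rows than columns; a nonzero vector of its left kernel is the list of coefficients
   of an algebraic relation. *)
have /rowV0Pn[c /sub_kermxP cA nzc] : kermx A != 0.
  rewrite kermx_eq0 /row_free; apply: contraTneq (rank_leq_col A) => ->.
  by rewrite -ltnNge !card_ffun !card_ord.
pose p : {mpoly k[m]} := \sum_i c 0 i *: 'X_[rowm (enum_val i)].
have p0 : p = 0.
  apply: indep; rewrite raddf_sum /=; apply/mpolyP => u.
  rewrite mcoeff0 raddf_sum /=.
  have [/forallP ltu|] := boolP [forall i, u i < C]%N.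
    pose h : column := [ffun i => Ordinal (ltu i)].
    have def_u : u = colm h by apply/mnmP => i; rewrite mnmE ffunE.
    transitivity ((c *m A) 0 (enum_rank h)); last by rewrite cA mxE.
    rewrite mxE; apply: eq_bigr => i _.
    by rewrite mxE enum_rankK comp_mpolyZ mcoeffZ -def_u.
  (* A monomial outside the box has degree too large to occur in any [F e]. *)
  rewrite negb_forall => /existsP[i]; rewrite -leqNgt => le_Cu.
  apply: big1 => j _; rewrite comp_mpolyZ mcoeffZ.
  rewrite [X in _ * X]memN_msupp_eq0 ?mulr0 //; apply: msize_mdeg_ge.
  rewrite comp_mpolyX; apply: leq_trans (msize_prod_leq _ hd) _.
  apply: leq_ltn_trans (_ : m * (B * d) < _)%N.
    rewrite -[X in (_ <= X * _)%N]card_ord -sum_nat_const.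
    by apply: leq_sum => l _; rewrite mnmE leq_mul2r ltnW ?orbT.
  by apply: leq_trans le_Cu _; rewrite mdegE (bigD1 i) //= leq_addr.
move: nzc; apply/negP/negPn/eqP/rowP => i; rewrite mxE.
have : p@_(rowm (enum_val i)) = 0 by rewrite p0 mcoeff0.
rewrite raddf_sum (bigD1 i) //= mcoeffZ mcoeffX eqxx mulr1 big1 ?addr0 //.
move=> j ne_ji; rewrite mcoeffZ mcoeffX; case: eqP => [eq_ij|]; last by rewrite mulr0.
case/eqP: ne_ji; apply/enum_val_inj/ffunP => l; apply/val_inj.
by move/mnmP/(_ l): eq_ij; rewrite !mnmE.
Qed.

End AlgebraicIndependence.

Section RowPolynomial.
Variables (R : nzRingType) (n : nat).

(** Over a commutative ring, its value at z is the product of the row with the column (1, z, z^2,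
    ...). *)
Definition row_poly (w : 'rV[R]_n) : {poly R} := \sum_j w 0 j *: 'X^j.

Lemma coef_row_poly w (i : 'I_n) : (row_poly w)`_i = w 0 i.
Proof.
rewrite coef_sum (bigD1 i) //= coefZ coefXn eqxx mulr1 big1 ?addr0 // => j ne_ji.
by rewrite coefZ coefXn val_eqE eq_sym (negPf ne_ji) mulr0.
Qed.

Lemma row_poly_inj : injective row_poly.
Proof. by move=> v w eq_vw; apply/rowP => i; rewrite -!coef_row_poly eq_vw. Qed.

End RowPolynomial.

(** The vector is taken on the moment curve (1, z, z^2, ...): each nonzero row excludes only the
    roots of a nonzero polynomial in z. *)
Lemma avoid_hyperplanes (L : closedFieldType) n (T : finType) (P : pred T)
    (r : T -> 'rV[L]_n) :
  (forall t, P t -> r t != 0) ->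
  exists w : 'cV[L]_n, forall t, P t -> r t *m w != 0.
Proof.
move=> nzr.
have : \prod_(t | P t) row_poly (r t) != 0.
  apply/prodf_neq0 => t Pt; apply: contraNneq (nzr t Pt) => rt0.
  apply/eqP/row_poly_inj; rewrite rt0 /row_poly big1 // => j _.
  by rewrite mxE scale0r.
case/closed_nonrootP => c; rewrite rootE horner_prod => /prodf_neq0 nzc.
exists (\col_j c ^+ j) => t Pt; apply: contraNneq (nzc t Pt) => rt0.
have := congr1 (fun M : 'M_1 => M 0 0) rt0; rewrite !mxE => <-.
rewrite horner_sum; apply/eqP/eq_bigr => j _.
by rewrite hornerZ hornerXn mxE.
Qed.

Section Orbits.
Variables (k : fieldType) (gT : finGroupType) (G : {group gT}) (n : nat).
Variables (rG : mx_representation k G n) (L : closedFieldType).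
Variable iota : {rmorphism k -> L}.

Lemma evalL_lin_subst (u : 'rV[L]_n) M j :
  evalL iota (tnth (lin_subst M) j) u = (u *m map_mx iota M) 0 j.
Proof.
rewrite tnth_mktuple /evalL (raddf_sum (map_mpoly iota)) (raddf_sum (meval _)) mxE; apply: eq_bigr => i _.
by rewrite /= map_mpolyZ mevalZ map_mpolyX mevalXU mxE mulrC.
Qed.

Lemma evalL_comp (u : 'rV[L]_n) M f :
  evalL iota (comp_mpoly (lin_subst M) f) u = evalL iota f (u *m map_mx iota M).
Proof.
elim/mpoly_gen_ind: f => [c|i|f g IHf IHg|f g IHf IHg].
- by rewrite comp_mpolyC /evalL !map_mpolyC !mevalC.
- rewrite comp_mpolyXU -tnth_nth evalL_lin_subst /evalL map_mpolyX mevalXU //.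
- by rewrite comp_mpolyD /evalL !rmorphD; congr (_ + _).
- by rewrite rmorphM /evalL !rmorphM; congr (_ * _).
Qed.

(* The coefficients of Prod_g (X - Sum_j (x g)_j Y^j) are invariants over k, and
   determine the orbit of x by unique factorization. *)
Lemma invariants_separate_orbits (u v : 'rV[L]_n) :
  (forall f, Defs.invariant rG f -> evalL iota f u = evalL iota f v) ->
  exists2 g, g \in G & v = u *m map_mx iota (rG g).
Proof.
move=> eq_uv.
pose Y g : {poly {mpoly k[n]}} :=
  row_poly (\row_j tnth (lin_subst (rG g)) j).
pose Phi := \prod_(g in G) ('X - (Y g)%:P).
have Phi_inv i j : Defs.invariant rG (Phi`_i)`_j.
  move=> h Gh; suff {2}<- :
      map_poly (map_poly (comp_mpoly (lin_subst (rG h)))) Phi = Phi.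
    by rewrite !coef_map.
  rewrite rmorph_prod /=.
  (* The action of [h] turns the factor at [g] into the factor at [h * g], so the product is only
     permuted. *)
  rewrite [RHS](reindex_inj (mulgI h)) /=.
  apply: eq_big => [g|g Gg]; first by rewrite groupMl.
  rewrite rmorphB /= map_polyX map_polyC /=; congr (_ - _%:P).
  rewrite raddf_sum; apply: eq_bigr => l _; rewrite /= map_polyZ map_polyXn !mxE.
  congr (_ *: _).
  rewrite !tnth_mktuple raddf_sum /= repr_mxM //.
  under eq_bigr => i1 _ do rewrite comp_mpolyZ comp_mpolyXU -tnth_nth tnth_mktuple scaler_sumr.
  rewrite exchange_big; apply: eq_bigr => i2 _ /=; rewrite mxE scaler_suml.
  by apply: eq_bigr => i1 _; rewrite scalerA mulrC.
pose ev (w : 'rV[L]_n) : {rmorphism {mpoly k[n]} -> L} :=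
  (meval (fun i => w 0 i) \o map_mpoly iota).
pose ev2 w := map_poly (map_poly (ev w)).
have evPhi w : ev2 w Phi =
    \prod_(g in G) ('X - (row_poly (w *m map_mx iota (rG g)))%:P).
  rewrite /ev2 rmorph_prod /=; apply: eq_bigr => g Gg.
  rewrite rmorphB /= map_polyX map_polyC /=; congr (_ - _%:P).
  rewrite raddf_sum; apply: eq_bigr => l _; rewrite /= map_polyZ map_polyXn.
  by rewrite [X in ev w X]mxE -evalL_lin_subst.
have eqPhi : ev2 u Phi = ev2 v Phi.
  apply/polyP => i; rewrite /ev2 !coef_map; apply/polyP => j; rewrite !coef_map.
  exact: eq_uv.
have : (ev2 u Phi).[row_poly v] == 0.
  rewrite eqPhi evPhi horner_prod (bigD1 1%g) //= repr_mx1 map_mx1 mulmx1.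
  by rewrite hornerXsubC subrr mul0r.
rewrite evPhi horner_prod => /prodf_eq0[g Gg].
rewrite hornerXsubC subr_eq0 => /eqP/row_poly_inj eq_v.
by exists g.
Qed.

End Orbits.

(** * Coprime products and slices of polynomials *)

Definition multiple_of (R : comNzRingType) (a : R) : R -> Prop :=
  fun x => exists w, x = a * w.

Section Products.
Variable R : comNzRingType.

Lemma nzd_mod_prod (I : R -> Prop) (T : Type) (s : seq T) (P : pred T) (b : T -> R) :
  (forall t, P t -> nzd_mod I (b t)) -> nzd_mod I (\prod_(t <- s | P t) b t).
Proof.
move=> hb; elim/big_rec: _ => [|t c Pt IH] x; first by rewrite mul1r.
by rewrite -mulrA => /(hb t Pt)/IH.
Qed.

Lemma span2C (i j a : R) : span2 i j a -> span2 j i a.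
Proof. by case=> u [v ->]; exists v, u; rewrite addrC. Qed.

Lemma span2M (i i' j a a' : R) :
  span2 i j a -> span2 i' j a' -> span2 (i * i') j (a * a').
Proof.
move=> [u [v ->]] [u' [v' ->]].
by exists (u * u'), (v * (i' * u' + j * v') + i * u * v'); ring.
Qed.

Lemma span2_prod (T : Type) (s : seq T) (P : pred T) (i a : T -> R) j :
  (forall t, P t -> span2 (i t) j (a t)) ->
  span2 (\prod_(t <- s | P t) i t) j (\prod_(t <- s | P t) a t).
Proof.
move=> h; elim/big_rec2: _ => [|t x y Pt IH].
  by exists 1, 0; rewrite mulr0 addr0 mulr1.
by apply: span2M => //; apply: h.
Qed.

Lemma span2_prod2 (T T' : finType) (P : pred T) (Q : pred T')
    (i : T -> R) (j : T' -> R) (a : T -> T' -> R) :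
  (forall s t, P s -> Q t -> span2 (i s) (j t) (a s t)) ->
  span2 (\prod_(s | P s) i s) (\prod_(t | Q t) j t)
        (\prod_(s | P s) \prod_(t | Q t) a s t).
Proof.
move=> h; apply: span2_prod => s Ps.
by apply/span2C/span2_prod => t Qt; apply/span2C/h.
Qed.

(** First a^k lies in (i, j^k), then its k-th power lies in (i^k, j^k). *)
Lemma span2X (i j a : R) k : span2 i j a -> span2 (i ^+ k) (j ^+ k) (a ^+ k ^+ k).
Proof.
move=> h; have hX (x y c : R) : span2 x y c -> span2 (x ^+ k) y (c ^+ k).
  move=> hxy; elim: k => [|k IH]; first by exists 1, 0; rewrite mulr0 addr0 mulr1.
  by rewrite !exprS; apply: span2M.
by apply: (hX) ; apply/span2C/hX/span2C.
Qed.

Lemma idealX_leq (I : R -> Prop) x k l : is_ideal I -> (k <= l)%N ->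
  I (x ^+ k) -> I (x ^+ l).
Proof. by move=> hI le_kl h; rewrite -(subnK le_kl) exprD; apply: idealM. Qed.

End Products.

(** In a domain the factors are divided out in turn: [x] is a multiple of one factor, and the
    quotient satisfies the same condition for the others. *)
Lemma nzd_multiple_prod (R : idomainType) (T : Type) (s : seq T) (P : pred T)
    (a : T -> R) b :
  (forall t, P t -> a t != 0) -> (forall t, P t -> nzd_mod (multiple_of (a t)) b) ->
  nzd_mod (multiple_of (\prod_(t <- s | P t) a t)) b.
Proof.
move=> nza hb; elim/big_rec: _ => [|t c Pt IH] x.
  by move=> _; exists x; rewrite mul1r.
case=> w bx; have [|y def_x] := hb t Pt x; first by exists (c * w); rewrite mulrA.
have [|z def_y] := IH y; last by exists z; rewrite def_x def_y mulrA.
exists w; apply: (mulfI (nza t Pt)).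
by rewrite mulrCA -def_x bx mulrA.
Qed.

Lemma multiple_of_exp (R : idomainType) (a b : R) k l : a != 0 ->
  nzd_mod (multiple_of a) b -> nzd_mod (multiple_of (a ^+ k)) (b ^+ l).
Proof.
move=> nza hb; rewrite -(card_ord k) -(card_ord l) -!prodr_const.
by apply: nzd_multiple_prod => // i _; apply: nzd_mod_prod.
Qed.

Section Slices.
Variables (L : fieldType) (N : nat).
Implicit Types (F G : {mpoly L[N]}) (i : 'I_N).

(* F as a polynomial in X_i whose coefficients do not involve X_i. *)
Definition slice i : {mpoly L[N]} -> {poly {mpoly L[N]}} :=
  locked (mmap (polyC \o @mpolyC N L)
    (fun l => if l == i then 'X else ('X_l)%:P)).

Lemma sliceD i F G : slice i (F + G) = slice i F + slice i G.
Proof. by rewrite /slice -lock mmapD. Qed.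

Lemma sliceN i F : slice i (- F) = - slice i F.
Proof. by rewrite /slice -lock mmapN. Qed.

Lemma sliceM i F G : slice i (F * G) = slice i F * slice i G.
Proof. by rewrite /slice -lock rmorphM. Qed.

Lemma sliceX i l : slice i 'X_l = if l == i then 'X else ('X_l)%:P.
Proof. by rewrite /slice -lock mmapX mmap1U. Qed.

Lemma sliceC i c : slice i c%:MP = (c%:MP)%:P.
Proof. by rewrite /slice -lock mmapC. Qed.

Lemma sliceZ i a F : slice i (a *: F) = a%:MP *: slice i F.
Proof. by rewrite -mul_mpolyC sliceM sliceC mul_polyC. Qed.

Lemma slice_sum i (T : finType) (F : T -> {mpoly L[N]}) :
  slice i (\sum_t F t) = \sum_t slice i (F t).
Proof.
apply: (big_morph _ (sliceD i)); apply: (addIr (slice i 0)).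
by rewrite -sliceD addr0 add0r.
Qed.

Lemma sliceK i F : (slice i F).['X_i] = F.
Proof.
elim/mpoly_gen_ind: F => [c|l|F G IF IG|F G IF IG].
- by rewrite sliceC hornerC.
- by rewrite sliceX; case: eqP => [->|_]; rewrite ?hornerX ?hornerC.
- by rewrite sliceD hornerD IF IG.
- by rewrite sliceM hornerM IF IG.
Qed.

(** Holds for ideals generated by polynomials free of X_i, whose membership passes to coefficients
    in X_i. *)
Definition slice_closed i (I : {mpoly L[N]} -> Prop) : Prop :=
  forall F, I F -> coefs_in I (slice i F).

Lemma nzd_slice i I F : is_ideal I -> slice_closed i I ->
  slice i F \is monic -> nzd_mod I F.
Proof.
move=> hI cI monF G IFG; rewrite -(sliceK i G) horner_coef.
apply: ideal_sum => // l _; rewrite mulrC; apply: idealM => //.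
apply: (coefs_in_nzd hI (N := slice i F)).
  by rewrite (monicP monF) => x; rewrite mul1r.
by rewrite -sliceM; apply: cI.
Qed.

Lemma slice_closed_span2 i a b : slice i a = a%:P -> slice i b = b%:P ->
  slice_closed i (span2 a b).
Proof.
move=> ha hb _ [u [v ->]] l; rewrite sliceD !sliceM ha hb coefD !coefCM.
by exists (slice i u)`_l, (slice i v)`_l.
Qed.

Lemma slice_closed_adjoin i I a : slice i a = a%:P ->
  slice_closed i I -> slice_closed i (ideal_adjoin I a).
Proof.
move=> ha hI F [v /hI hv] l; exists (slice i v)`_l.
by have := hv l; rewrite sliceD sliceN sliceM ha coefB coefCM.
Qed.

End Slices.

(** * Graphs of linear maps *)

Section Graphs.
Variables (L : closedFieldType) (n : nat).
Implicit Types (u v : 'rV[L]_n) (c w : 'cV[L]_n) (M : 'M[L]_n) (i j : 'I_n).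

(* The polynomial ring of V x V: the first n variables are the coordinates x,
   the last n ones the coordinates y. *)
Notation P := {mpoly L[n + n]}.

Definition point u v (l : 'I_(n + n)) : L := row_mx u v 0 l.

Definition xform c : P := \sum_i c i 0 *: 'X_(lshift n i).
Definition yform c : P := \sum_i c i 0 *: 'X_(rshift n i).
Definition graph_form M w : P := yform w - xform (M *m w).

Lemma pointE (e : 'I_(n + n) -> L) :
  e =1 point (\row_i e (lshift n i)) (\row_i e (rshift n i)).
Proof.
move=> i; rewrite /point -(splitK i); case: (split i) => j /=.
  by rewrite row_mxEl mxE.
by rewrite row_mxEr mxE.
Qed.

Lemma eval_xform c u v : (xform c).@[point u v] = (u *m c) 0 0.
Proof.
rewrite raddf_sum mxE; apply: eq_bigr => i _.
by rewrite /= mevalZ mevalXU /point row_mxEl mulrC.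
Qed.

Lemma eval_yform c u v : (yform c).@[point u v] = (v *m c) 0 0.
Proof.
rewrite raddf_sum mxE; apply: eq_bigr => i _.
by rewrite /= mevalZ mevalXU /point row_mxEr mulrC.
Qed.

Lemma eval_graph_form M w u v :
  (graph_form M w).@[point u v] = ((v - u *m M) *m w) 0 0.
Proof. by rewrite mevalB eval_xform eval_yform mulmxBl mulmxA !mxE. Qed.

Lemma xformB c c' : xform (c - c') = xform c - xform c'.
Proof. by rewrite -sumrB; apply: eq_bigr => i _; rewrite !mxE scalerBl. Qed.

Lemma xformZ a c : xform (a *: c) = a *: xform c.
Proof. by rewrite scaler_sumr; apply: eq_bigr => i _; rewrite !mxE scalerA. Qed.

Lemma graph_formB M M' w :
  graph_form M w - graph_form M' w = xform ((M' - M) *m w).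
Proof. by rewrite mulmxBl xformB opprB addrC addrA subrK. Qed.

Lemma mcoeff_xform c i : (xform c)@_U_(lshift n i) = c i 0.
Proof.
rewrite raddf_sum (bigD1 i) //= mcoeffZ mcoeffX eqxx mulr1 big1 ?addr0 // => j.
by rewrite mcoeffZ mcoeffX eq_mnm1 (inj_eq (@lshift_inj _ _)) => /negPf->; rewrite mulr0.
Qed.

Lemma xform_eq0 c : (xform c == 0) = (c == 0).
Proof.
apply/eqP/eqP => [c0|->]; last by rewrite /xform big1 // => i _; rewrite mxE scale0r.
by apply/colP => i; rewrite -mcoeff_xform c0 mcoeff0 mxE.
Qed.

Lemma slice_xform j c : slice (rshift n j) (xform c) = (xform c)%:P.
Proof.
rewrite slice_sum [in RHS]raddf_sum; apply: eq_bigr => i _.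
by rewrite sliceZ sliceX eq_lrshift /= -mul_mpolyC polyCM mul_polyC.
Qed.

Lemma slice_yform_delta i j : slice (rshift n j) (yform (delta_mx i 0)) =
  if i == j then 'X else (yform (delta_mx i 0))%:P.
Proof.
have -> : yform (delta_mx i 0) = 'X_(rshift n i).
  rewrite /yform (bigD1 i) //= mxE !eqxx scale1r big1 ?addr0 // => l ne_li.
  by rewrite mxE (negPf ne_li) scale0r.
by rewrite sliceX (inj_eq (@rshift_inj _ _)).
Qed.

Lemma slice_graph_form M i j :
  slice (rshift n j) (graph_form M (delta_mx i 0)) =
  if i == j then 'X - (xform (M *m delta_mx i 0))%:P
  else (graph_form M (delta_mx i 0))%:P.
Proof.
rewrite sliceD sliceN slice_xform slice_yform_delta.
by case: eqP => // _; rewrite -polyCB.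
Qed.

(* Substituting for x_i so as to kill the form c identifies P / (c) with a
   subring of P. *)
Lemma xform_coprime c c' i j : c i 0 != 0 -> c i 0 * c' j 0 != c j 0 * c' i 0 ->
  nzd_mod (multiple_of (xform c)) (xform c').
Proof.
move=> nzi nzij F [w eq_w].
pose X' (l : 'I_(n + n)) : P :=
  if l == lshift n i then 'X_l - (c i 0)^-1 *: xform c else 'X_l.
pose rho : {rmorphism P -> P} := mmap (@mpolyC _ L) X'.
have rhoX l : rho 'X_l = X' l by rewrite /= mmapX mmap1U.
have rhoC a : rho a%:MP = a%:MP by rewrite /= mmapC.
have rhoZ a (G : P) : rho (a *: G) = a *: rho G.
  by rewrite -!mul_mpolyC rmorphM rhoC.
have rho_xform d : rho (xform d) = xform (d - (d i 0 / c i 0) *: c).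
  rewrite xformB xformZ raddf_sum /= /xform (bigD1 i) // [in RHS](bigD1 i) //=.
  rewrite rhoZ rhoX /X' eqxx scalerBr scalerA [in RHS]addrAC; congr (_ + _).
  apply: eq_bigr => l ne_li; rewrite rhoZ rhoX /X' (inj_eq (@lshift_inj _ _)).
  by rewrite (negPf ne_li).
have mod_rho G : multiple_of (xform c) (G - rho G).
  elim/mpoly_gen_ind: G => [a|l|G H [g hg] [h hh]|G H [g hg] [h hh]].
  - by exists 0; rewrite rhoC mulr0 subrr.
  - rewrite rhoX /X'; case: eqP => _; last by exists 0; rewrite mulr0 subrr.
    by exists (c i 0)^-1%:MP; rewrite subKr -mul_mpolyC mulrC.
  - by exists (g + h); rewrite mulrDr -hg -hh rmorphD opprD addrACA.
  - exists (g * H + rho G * h); rewrite mulrDr mulrA -hg mulrCA -hh rmorphM.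
    by ring.
have /(congr1 rho) := eq_w; rewrite !rmorphM !rho_xform divff // scale1r subrr.
have /eqP-> : xform (0 : 'cV_n) == 0 by rewrite xform_eq0.
(* Either [rho F] is zero, and [F] is a multiple of the first form, or [c'] is proportional to [c],
   which the nonzero minor excludes. *)
rewrite mul0r => /eqP; rewrite mulf_eq0 xform_eq0 => /orP[|/eqP rF0].
  move/eqP/colP/(_ j); rewrite !mxE => /eqP; rewrite subr_eq0 => /eqP eqj.
  by case/eqP: nzij; rewrite eqj mulrA [c i 0 * _]mulrC divfK // mulrC.
by have := mod_rho F; rewrite rF0 subr0.
Qed.

(** Restricted to the line spanned by [e], F - a is a polynomial in one variable vanishing at every
    nonzero point, hence zero. *)
Lemma eval_line N (F : {mpoly L[N]}) (e : 'I_N -> L) a :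
  (forall z, z != 0 -> F.@[fun l => z * e l] = a) -> F.@[fun=> 0] = a.
Proof.
move=> hF; pose p : {poly L} := mmap polyC (fun l => e l *: 'X) F - a%:P.
have evp z : p.[z] = F.@[fun l => z * e l] - a.
  rewrite hornerD hornerN hornerC; congr (_ - _).
  elim/mpoly_gen_ind: F {hF p} => [b|i|F G IF IG|F G IF IG].
  - by rewrite mmapC hornerC mevalC.
  - by rewrite mmapX mmap1U hornerZ hornerX mevalXU mulrC.
  - by rewrite mmapD hornerD IF IG mevalD.
  - by rewrite rmorphM hornerM IF IG mevalM.
have p0 : p = 0.
  apply/eqP; apply: contraT => nzp.
  (* The factor X forces the chosen non-root to be nonzero. *)
  have /closed_nonrootP[z] : p * 'X != 0 by rewrite mulf_neq0 ?polyX_eq0.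
  rewrite rootE hornerM hornerX mulf_eq0 negb_or => /andP[+ nzz].
  by rewrite evp hF // subrr eqxx.
have := evp 0; rewrite p0 horner0 => /esym/eqP; rewrite subr_eq0 => /eqP <-.
by apply: meval_eq => i; rewrite mul0r.
Qed.

End Graphs.

(** * Connectedness in codimension one of an arrangement of graphs *)

Section GraphArrangement.
Variables (L : closedFieldType) (n m : nat) (T : finType).
Variables (M : T -> 'M[L]_n) (g : nat -> {mpoly L[n + n]}).
Hypothesis le_mn : (m <= n)%N.
Hypothesis cut_out : forall u v : 'rV[L]_n,
  (forall j, (j < m)%N -> (g j).@[point u v] = 0) <-> exists t, v = u *m M t.

(** By [cut_out] the common zeros of the [g j] are the points of the graphs, so the Nullstellensatz
    applies. *)
Let graph_equation F : (forall u t, F.@[point u (u *m M t)] = 0) ->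
  exists k, ideal_span m g (F ^+ k).
Proof.
move=> hF; apply: nullstellensatz; first exact: ideal_spanP.
move=> e he; rewrite (meval_eq _ (pointE e)).
set u := \row_i _; set v := \row_i _.
have [t ->] : exists t, v = u *m M t.
  apply/cut_out => j lt_jm; rewrite -(meval_eq _ (pointE e)); apply: he.
  exists (fun l => (l == j)%:R); rewrite (bigD1 (Ordinal lt_jm)) //= eqxx mul1r.
  by rewrite big1 ?addr0 // => l; rewrite -val_eqE => /negPf /= ->; rewrite mul0r.
exact: hF.
Qed.

Lemma eval_span_graph F u t : ideal_span m g F -> F.@[point u (u *m M t)] = 0.
Proof.
case=> c ->; rewrite raddf_sum big1 // => j _; rewrite /= mevalM.
have [_ h] := cut_out u (u *m M t).
by rewrite (h (ex_intro _ t erefl)) ?mulr0.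
Qed.

(* Over k[x], the y_j are integral modulo (g): the j-th element below is a power
   of prod_t (y_j - (x M_t)_j), and these elements form a regular sequence modulo
   any ideal generated by polynomials in x. *)
Lemma kacyclic_graphs a b :
  (forall j, slice (rshift n j) a = a%:P) ->
  (forall j, slice (rshift n j) b = b%:P) ->
  kacyclic (span2 a b) g m 1.
Proof.
move=> ha hb.
pose N0 (j : 'I_n) := \prod_t graph_form (M t) (delta_mx j 0).
have N0P (j : 'I_n) : exists k, ideal_span m g (N0 j ^+ k).
  apply: graph_equation => u t; rewrite rmorph_prod /= (bigD1 t) //=.
  by rewrite eval_graph_form subrr mul0mx mxE mul0r.
have {N0P} [k hk] := fin_all_exists N0P.
(* Indices [l >= n] receive the dummy value 0. *)
pose N l := if insub l is Some j then N0 j ^+ k j else 0.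
have NE (j : 'I_n) : N j = N0 j ^+ k j by rewrite /N valK.
pose Q := fix Q l := if l is l'.+1 then ideal_adjoin (Q l') (N l') else span2 a b.
have QI l : is_ideal (Q l).
  by elim: l => [|l IH] /=; [apply: span2P | apply: ideal_adjoinP].
have slice_N (i j : 'I_n) : slice (rshift n j) (N i) =
    if i == j then (\prod_t ('X - (xform (M t *m delta_mx j 0))%:P)) ^+ k j
    else (N i)%:P.
  rewrite NE; have slice_pow F l : slice (rshift n j) (F ^+ l) = slice (rshift n j) F ^+ l.
    elim: l => [|l IH]; last by rewrite !exprS sliceM IH.
    by rewrite !expr0 -mpolyC1 sliceC mpolyC1.
  have slice_prod (F : T -> _) :
      slice (rshift n j) (\prod_t F t) = \prod_t slice (rshift n j) (F t).
    apply: (big_morph _ (sliceM _)).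
    by rewrite -mpolyC1 sliceC mpolyC1.
  rewrite slice_pow slice_prod; case: eqP => [->|/eqP ne_ij].
    by congr (_ ^+ _); apply: eq_bigr => t _; rewrite slice_graph_form eqxx.
  rewrite !rmorphXn rmorph_prod; congr (_ ^+ _); apply: eq_bigr => t _.
  by rewrite slice_graph_form (negPf ne_ij).
apply: (kacyclic_regular (Q := Q) (N := N) le_mn) => // j lt_jn; last first.
  by rewrite (NE (Ordinal lt_jn)).
(* The generators of [Q j] are free of y_j, and [N j] is monic in y_j. *)
pose j' := Ordinal lt_jn; apply: (nzd_slice (i := rshift n j')) => //.
  have: (j <= j')%N by [].
  elim: {1 2}j => [|l IH] lt_lj /=; first exact: slice_closed_span2.
  apply: slice_closed_adjoin; last by apply: IH; apply: ltnW.
  rewrite -[l]/(val (Ordinal (ltn_trans lt_lj lt_jn))) slice_N ifN //.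
  by rewrite -val_eqE /= ltn_eqF.
rewrite (slice_N j' j') eqxx; apply: monic_exp; apply: monic_prod => t _.
exact: monicXsubC.
Qed.

Variable X : pred T.
Variables s0 t0 : T.
Hypotheses (Xs0 : X s0) (Xt0 : ~~ X t0).
(** The graphs of [M s] and [M t] meet above the kernel of M s - M t, so the two families meet in
    codimension at least two. *)
Hypothesis codim : forall s t, X s -> ~~ X t -> (1 < \rank (M s - M t)%R)%N.

Let form s t (w : 'cV[L]_n) := (M s - M t) *m w.

(** Some row of M s - M t is nonzero, and [w] is chosen off the hyperplanes defined by all such
    rows. *)
Lemma exists_transversal : exists w, forall s t, X s -> ~~ X t -> form s t w != 0.
Proof.
pose r (x : T * T * 'I_n) := row x.2 (M x.1.1 - M x.1.2).
have [w hw] := @avoid_hyperplanes _ _ _ (fun x => r x != 0) r (fun _ => id).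
exists w => s t Xs Xt; have := codim Xs Xt; rewrite -/(form s t w) => rk.
have [i nzi] : exists i, row i (M s - M t) != 0.
  apply/existsP; apply: contraTT rk; rewrite negb_exists => /forallP r0.
  suff -> : M s - M t = 0 by rewrite mxrank0.
  by apply/row_matrixP => i; rewrite row0; apply/eqP; rewrite -[_ == _]negbK r0.
apply: contraNneq (hw (s, t, i) nzi) => f0.
by rewrite /r /= -row_mul -/(form s t w) f0 row0.
Qed.

(** The 2 x 2 minors are linear in [w']. If those through a row [i] with [form s t w i 0 != 0] all
    vanished identically, M s' - M t' would have rank at most one, against [codim]. *)
Lemma exists_independent_transversal w :
  (forall s t, X s -> ~~ X t -> form s t w != 0) ->
  exists w', forall s t s' t', X s -> ~~ X t -> X s' -> ~~ X t' ->
    exists i j, form s t w i 0 != 0 /\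
      form s t w i 0 * form s' t' w' j 0 != form s t w j 0 * form s' t' w' i 0.
Proof.
move=> hw.
pose r (x : (T * T) * (T * T) * ('I_n * 'I_n)) :=
  form x.1.1.1 x.1.1.2 w x.2.1 0 *: row x.2.2 (M x.1.2.1 - M x.1.2.2) -
  form x.1.1.1 x.1.1.2 w x.2.2 0 *: row x.2.1 (M x.1.2.1 - M x.1.2.2).
have [w' hw'] := @avoid_hyperplanes _ _ _ (fun x => r x != 0) r (fun _ => id).
exists w' => s t s' t' Xs Xt Xs' Xt'.
have /cV0Pn[i nzi] := hw s t Xs Xt.
have [j nzr] : exists j, r ((s, t), (s', t'), (i, j)) != 0.
  apply/existsP; apply: contraTT (codim Xs' Xt').
  rewrite negb_exists => /forallP r0; rewrite -leqNgt.
  suff -> : M s' - M t' =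
      ((form s t w i 0)^-1 *: form s t w) *m row i (M s' - M t').
    by apply: leq_trans (mxrankM_maxl _ _) (rank_leq_col _).
  apply/row_matrixP => j; rewrite row_mul; apply/rowP => l.
  have /negPn/eqP/rowP/(_ l) := r0 j; rewrite [X in _ = X]mxE [X in X = _]mxE.
  rewrite [X in X + _]mxE [X in _ + X]mxE [X in _ - X]mxE => /eqP.
  rewrite subr_eq0 => /eqP e; rewrite [RHS]mxE big_ord1 [X in _ = X * _]mxE.
  by rewrite [X in _ = X * _]mxE -mulrA -e mulKf.
exists i, j; split=> //; apply: contraNneq (hw' _ nzr) => e.
rewrite mulmxBl -!scalemxAl -!row_mul; apply/eqP/matrixP => p q.
rewrite !ord1 [RHS]mxE [LHS]mxE [X in X + _]mxE [X in _ + X]mxE [X in _ - X]mxE.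
rewrite [X in _ * X - _]mxE [X in _ - _ * X]mxE.
by apply/eqP; rewrite subr_eq0; apply/eqP.
Qed.

(* Hartshorne's argument: a function equal to 0 on one part of the arrangement and
   to 1 on the other would exist near the origin, which lies on both parts. *)
Theorem graphs_connected : False.
Proof.
have [w1 hw1] := exists_transversal.
have [w2 hw2] := exists_independent_transversal hw1.
have nzf1 s t : X s -> ~~ X t -> form s t w1 != 0 by exact: hw1.
have nzf2 s t : X s -> ~~ X t -> form s t w2 != 0.
  move=> Xs Xt; have [i [j [nzi]]] := hw2 s t s t Xs Xt Xs Xt.
  by apply: contraNneq => ->; rewrite !mxE !mulr0.
(* [A w] vanishes on the graphs in [X] and [B w] on the others; [D w] involves x alone and lies in
   (A w, B w). *)
pose A w := \prod_(s | X s) graph_form (M s) w.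
pose B w := \prod_(t | ~~ X t) graph_form (M t) w.
pose D w := \prod_(s | X s) \prod_(t | ~~ X t) xform (form s t w).
have evA w u s : X s -> (A w).@[point u (u *m M s)] = 0.
  move=> Xs; rewrite rmorph_prod (bigD1 s) //= eval_graph_form subrr mul0mx.
  by rewrite mxE mul0r.
have evB w u t : ~~ X t -> (B w).@[point u (u *m M t)] = 0.
  move=> Xt; rewrite rmorph_prod (bigD1 t) //= eval_graph_form subrr mul0mx.
  by rewrite mxE mul0r.
have ABvanish w w' u t : (A w * B w').@[point u (u *m M t)] = 0.
  by rewrite mevalM; case: (boolP (X t)) => Xt; [rewrite evA ?mul0r|rewrite evB ?mulr0].
have gI := ideal_spanP m g.
(* The mixed products vanish on every graph. Positivity of [k] makes the k-th power of 0 vanish in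
   the final evaluations. *)
have [k [k_gt0 gAB gBA]] : exists k, [/\ (0 < k)%N,
    ideal_span m g ((A w1 * B w2) ^+ k) & ideal_span m g ((A w2 * B w1) ^+ k)].
  have [k1 h1] := graph_equation (ABvanish w1 w2).
  have [k2 h2] := graph_equation (ABvanish w2 w1).
  by exists (k1 + k2).+1; split=> //; apply: (idealX_leq gI) (_ : (_ <= _)%N) _;
     [|exact: h1| |exact: h2]; lia.
have spanD w : span2 (A w) (B w) (D w).
  apply: span2_prod2 => s t Xs Xt; exists (-1), 1.
  by rewrite mulr1 mulrN1 addrC graph_formB.
have [p1 [q1 def_a]] := span2X k (spanD w1).
have [p2 [q2 def_b]] := span2X k (spanD w2).
set a := D w1 ^+ k ^+ k in def_a; set b := D w2 ^+ k ^+ k in def_b.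
have nzD w : (forall s t, X s -> ~~ X t -> form s t w != 0) -> D w != 0.
  move=> nzf; apply/prodf_neq0 => s Xs; apply/prodf_neq0 => t Xt.
  by rewrite xform_eq0 nzf.
have coprime_ab : nzd_mod (multiple_of a) b.
  have nzD1 := nzD w1 nzf1.
  apply: multiple_of_exp; first exact: expf_neq0.
  apply: multiple_of_exp => //.
  apply: nzd_multiple_prod => [s Xs|s Xs].
    by apply/prodf_neq0 => t Xt; rewrite xform_eq0 nzf1.
  apply: nzd_multiple_prod => [t Xt|t Xt]; first by rewrite xform_eq0 nzf1.
  apply: nzd_mod_prod => s' Xs'; apply: nzd_mod_prod => t' Xt'.
  have [i [j [nzi nzij]]] := hw2 s t s' t' Xs Xt Xs' Xt'.
  exact: xform_coprime nzi nzij.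
have slice1 l : slice l (1 : {mpoly L[n + n]}) = 1.
  by rewrite -mpolyC1 sliceC mpolyC1.
have slice_D w j : slice (rshift n j) (D w ^+ k ^+ k) = (D w ^+ k ^+ k)%:P.
  have slice_pow (F : {mpoly L[n + n]}) : slice (rshift n j) F = F%:P ->
      slice (rshift n j) (F ^+ k) = (F ^+ k)%:P.
    move=> hF; elim: (k) => [|l IH]; first by rewrite !expr0 slice1.
    by rewrite !exprS sliceM IH hF polyCM.
  apply/slice_pow/slice_pow; rewrite (big_morph _ (sliceM _) (slice1 _)) rmorph_prod.
  apply: eq_bigr => s _; rewrite (big_morph _ (sliceM _) (slice1 _)) rmorph_prod.
  by apply: eq_bigr => t _; rewrite slice_xform.
pose J x := exists y z, [/\ ideal_span m g y, ideal_span m g z & x = a * y + b * z].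
have JI : is_ideal J.
  split.
  - by exists 0, 0; split; rewrite ?mulr0 ?addr0 //; apply: ideal0.
  - move=> _ _ [y [z [gy gz ->]]] [y' [z' [gy' gz' ->]]].
    exists (y + y'), (z + z'); split; try exact: idealD.
    by rewrite !mulrDr addrACA.
  - move=> r _ [y [z [gy gz ->]]]; exists (r * y), (r * z).
    by split; try exact: idealM; rewrite mulrDr !(mulrCA r).
(* Where they are defined, f / a and f' / b are the same function on the arrangement: 0 on the
   graphs in [X], 1 on the others. *)
pose f := A w1 ^+ k * p1; pose f' := A w2 ^+ k * p2.
have gf : ideal_span m g (b * f - a * f').
  have -> : b * f - a * f' = p1 * q2 * (A w1 * B w2) ^+ k -
      p2 * q1 * (A w2 * B w1) ^+ k.
    by rewrite def_a def_b /f /f' !exprMn; ring.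
  by apply: idealB => //; apply: idealM.
(* [J] is the product of (a, b) and (g). The element lies in both ideals, hence in [J] by the
   vanishing of Koszul homology modulo (a, b). *)
have /= : J (b * f - a * f').
  case: gf => h def_h; rewrite def_h.
  apply: (kacyclic_relation (I := span2 a b) (span2P a b) JI).
  - by apply: kacyclic_graphs => j; apply: slice_D.
  - move=> j _ lt_jm [u [v ->]]; exists (u * g j), (v * g j).
    have gj : ideal_span m g (g j).
      exists (fun l => (l == j)%:R); rewrite (bigD1 (Ordinal lt_jm)) //= eqxx mul1r.
      by rewrite big1 ?addr0 // => l; rewrite -val_eqE => /negPf /= ->; rewrite mul0r.
    by split; try exact: idealM; ring.
  - by rewrite -def_h; exists (- f'), f; ring.
case=> y [z [gy gz e]].
(* Here b (f - z) = a (f' + y), so [a] divides f - z: the quotient [c] extends f / a to a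
   polynomial. *)
have [|c def_c] := coprime_ab (f - z).
  by exists (f' + y); rewrite mulrBr mulrDr; apply/eqP;
     rewrite subr_eq -addrA -e addrC subrK.
have {}def_c : f = a * c + z by rewrite -def_c subrK.
(* No factor of [a] vanishes at [u], so [a] is nonzero at every nonzero multiple of [u]. *)
have [u hu] : exists u : 'rV[L]_n,
    forall s t, X s -> ~~ X t -> (u *m form s t w1) 0 0 != 0.
  pose r (x : T * T) := (form x.1 x.2 w1)^T.
  have [|v hv] := @avoid_hyperplanes _ _ _ (fun x => X x.1 && ~~ X x.2) r.
    by move=> [s t] /= /andP[Xs Xt]; rewrite /r trmx_eq0 nzf1.
  exists v^T => s t Xs Xt; have := hv (s, t); rewrite /= Xs Xt => /(_ isT).
  apply: contraNneq => e0; apply/eqP/matrixP => i j; rewrite !ord1 [RHS]mxE -e0.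
  by rewrite -[in RHS](trmxK (_ *m _)) trmx_mul trmxK [RHS]mxE.
have nza l v : l != 0 -> a.@[point (l *: u) v] != 0.
  move=> nzl; rewrite !rmorphXn !expf_neq0 // rmorph_prod.
  apply/prodf_neq0 => s Xs; rewrite rmorph_prod; apply/prodf_neq0 => t Xt.
  by rewrite /= eval_xform -scalemxAl mxE mulf_neq0 ?hu.
have evc t l : c.@[fun i => l * point u (u *m M t) i] =
    c.@[point (l *: u) (l *: u *m M t)].
  apply: meval_eq => i; rewrite /point -scalemxAl -scale_row_mx [RHS]mxE //.
have eval_f t l : f.@[point (l *: u) (l *: u *m M t)] =
    a.@[point (l *: u) (l *: u *m M t)] * c.@[point (l *: u) (l *: u *m M t)].
  by rewrite def_c mevalD mevalM (eval_span_graph _ _ gz) addr0.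
(* Above the line of [u], a c = f is 0 on the graph of [M s0] and [a] on that of [M t0]; both lines
   pass through the origin. *)
have c0 : c.@[fun=> 0] = 0.
  apply: (eval_line (e := point u (u *m M s0))) => l nzl; rewrite evc.
  apply: (mulfI (nza l (l *: u *m M s0) nzl)); rewrite -eval_f mulr0.
  by rewrite mevalM rmorphXn /= evA // expr0n eqn0Ngt k_gt0 mul0r.
have c1 : c.@[fun=> 0] = 1.
  apply: (eval_line (e := point u (u *m M t0))) => l nzl; rewrite evc.
  apply: (mulfI (nza l (l *: u *m M t0) nzl)); rewrite -eval_f mulr1 def_a.
  rewrite mevalD [X in _ = _ + X]mevalM rmorphXn /= evB //.
  by rewrite expr0n eqn0Ngt k_gt0 mul0r addr0.
by move/eqP: c1; rewrite c0 eq_sym oner_eq0.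
Qed.

End GraphArrangement.

(** * Reflections *)

Section Difference.
Variables (L : closedFieldType) (n : nat).

Definition difference_poly (F : {mpoly L[n]}) : {mpoly L[n + n]} :=
  comp_mpoly [tuple 'X_(lshift n i) | i < n] F -
  comp_mpoly [tuple 'X_(rshift n i) | i < n] F.

Lemma eval_difference F (u v : 'rV[L]_n) :
  (difference_poly F).@[point u v] = F.@[fun i => u 0 i] - F.@[fun i => v 0 i].
Proof.
rewrite mevalB !comp_mpoly_meval.
by congr (_ - _); apply: meval_eq => i;
  rewrite tnth_mktuple mevalXU /point ?row_mxEl ?row_mxEr.
Qed.

End Difference.

Lemma evalL_comp_eq (k : fieldType) (L : closedFieldType) (iota : {rmorphism k -> L})
    n m (f : m.-tuple {mpoly k[n]}) (u v : 'rV[L]_n) p :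
  (forall i, evalL iota (tnth f i) u = evalL iota (tnth f i) v) ->
  evalL iota (comp_mpoly f p) u = evalL iota (comp_mpoly f p) v.
Proof.
move=> huv; elim/mpoly_gen_ind: p => [c|i|p q IHp IHq|p q IHp IHq].
- by rewrite comp_mpolyC /evalL !map_mpolyC !mevalC.
- by rewrite comp_mpolyXU -tnth_nth.
- by rewrite comp_mpolyD /evalL !rmorphD; congr (_ + _).
- by rewrite rmorphM /evalL !rmorphM; congr (_ * _).
Qed.

Theorem theorem1p1 (k : fieldType) (gT : finGroupType) (G : {group gT})
    (n : nat) (rG : mx_representation k G n)
    (L : closedFieldType) (iota : {rmorphism k -> L}) :
  is_algebraic_closure iota ->
  (exists A : {mpoly k[n]} -> Prop,
      geometric_separating rG iota A /\ polynomial_subalgebra A) ->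
  generated_by_reflections rG.
Proof.
move=> _ [A [[A_inv A_sep] [m [f [f_indep def_A]]]]] g0 Gg0.
have le_mn := algebraically_independent_leq f_indep.
have Af i : A (tnth f i) by apply/def_A; exists 'X_i; rewrite comp_mpolyXU -tnth_nth.
pose T := {x : gT | x \in G}.
pose M (x : T) := map_mx iota (rG (val x)).
pose d j : {mpoly L[n + n]} := difference_poly (map_mpoly iota f`_j).
(* If the generators of [A] agree at two points, so do all invariants by separation, and the points
   share an orbit. *)
have cut_out (u v : 'rV[L]_n) :
    (forall j, (j < m)%N -> (d j).@[point u v] = 0) <-> exists t, v = u *m M t.
  have dE (i : 'I_m) :
      (d i).@[point u v] = evalL iota (tnth f i) u - evalL iota (tnth f i) v.
    by rewrite /d eval_difference -tnth_nth.
  split=> [d0|[x ->] j lt_jm].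
    have [|g Gg ->] := @invariants_separate_orbits _ _ _ _ rG _ iota u v.
      apply/A_sep => _ /def_A[p ->]; apply: evalL_comp_eq => i.
      by apply/eqP; rewrite -subr_eq0 -dE d0.
    by exists (exist _ g Gg).
  rewrite (eval_difference _ u) /M -[j]/(val (Ordinal lt_jm)) -tnth_nth.
  apply/eqP; rewrite subr_eq0 -/(evalL _ _ u) -/(evalL _ _ (u *m _)) -evalL_comp.
  by rewrite (A_inv _ (Af _)) ?(valP x).
set H := <<[set x in G | is_reflection rG x]>>%g.
have sHG : H \subset G by rewrite gen_subG; apply/subsetP => x; rewrite inE => /andP[].
(* Membership is tested on images in GL(V), since [rG] may fail to be faithful. *)
pose X (x : T) := [exists r in H, rG r == rG (val x)].
apply: NNPP => ng0.
apply: (@graphs_connected L n m T M d le_mn cut_out X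
  (exist _ 1%g (group1 G)) (exist _ g0 Gg0)).
- by apply/existsP; exists 1%g; rewrite group1 eqxx.
- apply/negP => /existsP[r /andP[Hr /eqP eq_r]].
  by apply: ng0; exists r.
(* By contraposition: if rG s - rG t has rank at most 1, then s t^-1 acts trivially or as a
   reflection, so [t] is in [X] along with [s]. *)
move=> [s Gs] [t Gt] /existsP[r /andP[Hr /eqP eq_r]]; rewrite /= in eq_r.
apply: contraR; rewrite -map_mxB mxrank_map /= -leqNgt => rk.
have def_st : rG s - rG t = (rG (s * t^-1)%g - 1%:M) *m rG t.
  by rewrite mulmxBl mul1mx -repr_mxM ?groupM ?groupV // mulgKV.
apply/existsP; move: rk; rewrite def_st mxrankMfree ?row_free_unit ?repr_mx_unit //.
rewrite leq_eqVlt ltnS leqn0 => /orP[rk1|rk0]; last first.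
  exists r; rewrite Hr eq_r /= -subr_eq0 def_st.
  by move: rk0; rewrite mxrank_eq0 => /eqP ->; rewrite mul0mx.
have Hst : (s * t^-1)%g \in H.
  by apply: mem_gen; rewrite inE /is_reflection groupM ?groupV.
have Gr := subsetP sHG r Hr.
exists ((s * t^-1)^-1 * r)%g; rewrite groupM ?groupV //= repr_mxM //; last first.
  by rewrite groupV groupM ?groupV.
by rewrite eq_r -repr_mxM ?groupV ?groupM ?groupV // invMg invgK mulgKV.
Qed.
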